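(* Let $\tau$ be a smooth $\mathbb{R}^n$-action on $\mathbb{R}^n$ with order $\boldsymbol b$ and support in some compact set $K\subset\mathbb{R}^n$. Then its pullback $(\alpha^K_xf)(y):=f(\tau_x(y))$, $x,y\in\mathbb{R}^n$, is a smooth polynomially bounded $\mathbb{R}^n$-action (of some order) on $C^\infty(\mathbb{R}^n,\mathbb{C})$, on each symbol space $\mathrm S^{m,\rho}(\mathbb{R}^n,\mathbb{C})$, $m,\rho\in\mathbb{R}$, and on the Schwartz space $\mathscr S(\mathbb{R}^n,\mathbb{C})$.
   Context: Compactly supported actions. Let $K\subset\mathbb{R}^n$ be compact and $\boldsymbol b=\{b_l\}_{l\in\mathbb{N}_0}$ a sequence of non-negative reals with $b_0=0$. A smooth $\mathbb{R}^n$-action with support in $K$ and order $\boldsymbol b$ is a smooth function $\tau\colon\mathbb{R}^n\times\mathbb{R}^n\to\mathbb{R}^n$ such that (1) $\tau_x(\tau_{x'}(y))=\tau_{x+x'}(y)$ for all $x,x',y$ (and $\tau_0=\mathrm{id}$); (2) $\tau_x(y)=y$ for all $x\in\mathbb{R}^n$, $y\in\mathbb{R}^n\setminus K$; (3) for each $\mu\in\mathbb{N}_0^n$, $l\in\mathbb{N}_0$ there is $c_{l\mu}>0$ with $\sup_{y\in K,\,|\nu|\le l,\,1\le j\le n}|\partial_y^\nu\partial_x^\mu\tau_x(y)_j|\le c_{l\mu}(1+\|x\|^2)^{\frac12b_l}$ for all $x\in\mathbb{R}^n$. Symbols. For a sequentially complete locally convex space $V$ (complex, Hausdorff) with a defining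 system $\mathcal Q$ of continuous seminorms (generating the topology), an order for $\mathcal Q$ is a map $\boldsymbol m\colon\mathcal Q\to\mathbb R$. $\mathrm S^{\boldsymbol m,0}(\mathbb{R}^n,V)$ is the space of all $F\in C^\infty(\mathbb{R}^n,V)$ such that for all $\mathrm q\in\mathcal Q$, $\mu\in\mathbb{N}_0^n$ $$\|F\|^{\boldsymbol m,0}_{\mathrm q,\mu}=\sup_{x}(1+\|x\|^2)^{-\frac12\boldsymbol m(\mathrm q)}\mathrm q(\partial^\mu F(x))<\infty,$$ topologized by these seminorms. Polynomially bounded actions. An $\mathbb{R}^n$-action $\alpha$ on $V$ by linear maps is smooth polynomially bounded of order $\boldsymbol m$ if $\alpha(v)\colon x\mapsto\alpha_x(v)$ lies in $\mathrm S^{\boldsymbol m,0}(\mathbb{R}^n,V)$ for each $v\in V$ and $V\ni v\mapsto\alpha(v)\in\mathrm S^{\boldsymbol m,0}(\mathbb{R}^n,V)$ is continuous. Function spaces and their defining systems. $C^\infty(\mathbb{R}^n,\mathbb{C})$ carries the seminorms $\mathrm p_{J,l}(f)=\sup_{x\in J,|\mu|\le l}|\partial^\mu f(x)|$, $J\subset\mathbb{R}^n$ compact, $l\in\mathbb{N}_0$. For $m,\rho\in\mathbb R$, $\mathrm S^{m,\rho}(\mathbb{R}^n,\mathbb{C})$ is the space of $f\in C^\infty(\mathbb{R}^n,\mathbb C)$ with $\|f\|^{m,\rho}_\mu=\sup_x(1+\|x\|^2)^{-\frac12(m-\rho|\mu|)}|\partial^\mu f(x)|<\infty$ for all $\mu\in\mathbb{N}_0^n$,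 with these seminorms. $\mathscr S(\mathbb{R}^n,\mathbb{C})$ is the usual Schwartz space with seminorms $\sup_x(1+\|x\|^2)^{m/2}|\partial^\mu f(x)|$, $m\in\mathbb{N}_0$, $\mu\in\mathbb{N}_0^n$. *)

(* Defs.v *)
From HB Require Import structures.
From mathcomp Require Import all_boot all_order all_algebra.
From mathcomp Require Import all_classical all_reals all_analysis.
From mathcomp Require Import complex.

Set Implicit Arguments.
Unset Strict Implicit.
Unset Printing Implicit Defensive.

Import Order.TTheory GRing.Theory Num.Theory.
Import numFieldNormedType.Exports.

Local Open Scope classical_set_scope.
Local Open Scope ring_scope.

(* A complex Hausdorff locally convex space, presented by a defining system of
   seminorms [lcs_sn], which generates its topology.  Sequential completeness
   is not required: it plays no role in the notions below.  [Normc.normc] is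
   the real-valued modulus of [R[i]].                                         *)
Record lcs (R : realType) := Lcs {
  lcs_mod : lmodType R[i];
  lcs_idx : Type;
  lcs_sn : lcs_idx -> lcs_mod -> R;
  lcs_snD : forall q u v, lcs_sn q (u + v) <= lcs_sn q u + lcs_sn q v;
  lcs_snZ : forall q c u, lcs_sn q (c *: u) = Normc.normc c * lcs_sn q u;
  lcs_sep : forall u, (forall q, lcs_sn q u = 0) -> u = 0 }.

Definition lcs_space (R : realType) (V : lcs R) : Type := lcs_mod V.
Coercion lcs_space : lcs >-> Sortclass.

HB.instance Definition _ (R : realType) (V : lcs R) :=
  GRing.Lmodule.copy (lcs_space V) (lcs_mod V).

Section lcs_topology.
Variables (R : realType) (V : lcs R).
Implicit Types (D : set (lcs_idx V)) (u v w : V).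

Definition lcs_ball D (e : R) v : set V :=
  [set w | forall q, D q -> lcs_sn q (w - v) < e].

Definition lcs_nbhs v : set_system V :=
  [set A | exists D (e : R), [/\ finite_set D, 0 < e & lcs_ball D e v `<=` A]].

Lemma lcs_sn0 (q : lcs_idx V) : lcs_sn q (0 : V) = 0.
Proof.
by rewrite -[X in lcs_sn q X](scale0r (0 : V)) lcs_snZ Normc.normc0 mul0r.
Qed.

Lemma lcs_snN (q : lcs_idx V) v : lcs_sn q (- v) = lcs_sn q v.
Proof. by rewrite -scaleN1r lcs_snZ normcN Normc.normc1 mul1r. Qed.

Lemma lcs_sn_ge0 (q : lcs_idx V) v : 0 <= lcs_sn q v.
Proof.
have := lcs_snD q v (- v); rewrite lcs_snN subrr lcs_sn0.
by rewrite -mulr2n pmulrn_lge0.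
Qed.

Lemma lcs_sn_sub (q : lcs_idx V) u v w :
  lcs_sn q (u - w) <= lcs_sn q (u - v) + lcs_sn q (v - w).
Proof. by rewrite -(subrKA v u (- w)); exact: lcs_snD. Qed.

Lemma lcs_ball_center D e v : 0 < e -> lcs_ball D e v v.
Proof. by move=> e0 q _; rewrite subrr lcs_sn0. Qed.

Lemma lcs_ball_half D e v w :
  lcs_ball D (e / 2) v w -> lcs_ball D (e / 2) w `<=` lcs_ball D e v.
Proof.
move=> vw u wu q Dq; apply: (le_lt_trans (lcs_sn_sub q u w v)).
by rewrite [e]splitr ltrD// ?wu ?vw.
Qed.

Lemma lcs_nbhs_filter v : ProperFilter (lcs_nbhs v).
Proof.
split; first by move=> [D [e [_ e0 /(_ v (@lcs_ball_center D _ v e0))]]].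
split.
- by exists set0, 1; split.
- move=> A B [D [e [Df e0 DA]]] [D' [e' [D'f e'0 DB]]].
  exists (D `|` D'), (Num.min e e'); split.
  + by rewrite finite_setU.
  + by rewrite lt_min e0.
  + move=> w Dw; split; [apply: DA|apply: DB] => q Dq.
      by have := Dw q (or_introl Dq); rewrite lt_min => /andP[].
    by have := Dw q (or_intror Dq); rewrite lt_min => /andP[].
- by move=> A B AB [D [e [Df e0 DA]]]; exists D, e; split => // w /DA /AB.
Qed.

Lemma lcs_nbhs_singleton v (A : set V) : lcs_nbhs v A -> A v.
Proof. by move=> [D [e [_ e0 DA]]]; apply/DA/lcs_ball_center. Qed.

Lemma lcs_nbhs_nbhs v (A : set V) : lcs_nbhs v A -> lcs_nbhs v (lcs_nbhs^~ A).
Proof.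
move=> [D [e [Df e0 DA]]]; have e20 : 0 < e / 2 by rewrite divr_gt0.
exists D, (e / 2); split => // w vw; exists D, (e / 2); split => //.
by apply: subset_trans DA; exact: lcs_ball_half.
Qed.

End lcs_topology.

HB.instance Definition _ (R : realType) (V : lcs R) :=
  hasNbhs.Build (lcs_space V) (@lcs_nbhs R V).
HB.instance Definition _ (R : realType) (V : lcs R) :=
  Nbhs_isNbhsTopological.Build (lcs_space V) (@lcs_nbhs_filter R V)
    (@lcs_nbhs_singleton R V) (@lcs_nbhs_nbhs R V).

Section lcs_tvs.
Variables (R : realType) (V : lcs R).

Lemma lcs_nbhsE (v : V) : nbhs v = lcs_nbhs v. Proof. by []. Qed.

Lemma normc_normr (c : R[i]) : (Normc.normc c)%:C%C = `|c|.
Proof. by case: c. Qed.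

Lemma normc_ge0 (c : R[i]) : 0 <= Normc.normc c.
Proof. by case: c => a b; rewrite sqrtr_ge0. Qed.

Lemma lcs_add_continuous : continuous (fun x : V * V => x.1 + x.2).
Proof.
move=> [u v] A /= [D [e [Df e0 DA]]]; have e20 : 0 < e / 2 by rewrite divr_gt0.
exists (lcs_ball D (e / 2) u, lcs_ball D (e / 2) v) => /=.
  by split; (exists D, (e / 2); split).
move=> [u' v'] /= [uu' vv']; apply: DA => q Dq.
rewrite opprD addrACA (le_lt_trans (lcs_snD _ _ _))//.
by rewrite [e]splitr ltrD// ?uu' ?vv'.
Qed.

Lemma finite_sn_bound (D : set (lcs_idx V)) (u : V) : finite_set D ->
  exists2 M : R, 0 < M & forall q, D q -> lcs_sn q u < M.
Proof.
move=> Df; have /finite_seqP[s sE] : finite_set [set lcs_sn q u | q in D].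
  exact: finite_image.
exists (1 + \sum_(x <- s) `|x|); first by rewrite ltr_pwDl// sumr_ge0.
move=> q Dq; have : lcs_sn q u \in s.
  have : [set lcs_sn q u | q in D] (lcs_sn q u) by exists q.
  by rewrite sE.
move=> qs; rewrite (big_rem _ qs)/= (le_lt_trans (ler_norm _))//.
by rewrite ltr_pwDl// lerDl sumr_ge0.
Qed.

Lemma lcs_scale_continuous : continuous (fun z : R[i]^o * V => z.1 *: z.2).
Proof.
move=> [c u] A /= [D [e [Df e0 DA]]].
have [M M0 uM] := finite_sn_bound u Df.
have e20 : 0 < e / 2 by rewrite divr_gt0.
pose N := Normc.normc c + 1.
have N0 : 0 < N by rewrite ltr_wpDl//; rewrite normc_ge0.
pose d := Num.min 1 (e / 2 / M).
have d0 : 0 < d by rewrite lt_min ltr01 divr_gt0.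
exists (ball (c : R[i]^o) d%:C%C, lcs_ball D (e / 2 / N) u) => /=.
  split; first by apply: nbhsx_ballx; rewrite ltcR.
  by exists D, (e / 2 / N); split => //; rewrite divr_gt0.
move=> [c' u'] /= [cc' uu']; apply: DA => q Dq.
have {}cc' : Normc.normc (c' - c) < d.
  by rewrite -ltcR normc_normr distrC; exact: cc'.
have c'N : Normc.normc c' <= N.
  rewrite -[c'](subrK c) addrC (le_trans (le_normcD _ _))// lerD2l.
  by rewrite (le_trans (ltW cc'))// ge_min lexx.
have -> : c' *: u' - c *: u = c' *: (u' - u) + (c' - c) *: u.
  by rewrite scalerBr scalerBl addrA subrK.
rewrite (le_lt_trans (lcs_snD _ _ _))// !lcs_snZ [e]splitr ltr_leD//.
  rewrite (@le_lt_trans _ _ (N * lcs_sn q (u' - u)))//.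
    by rewrite ler_wpM2r// lcs_sn_ge0.
  by rewrite mulrC -ltr_pdivlMr// uu'.
rewrite (@le_trans _ _ (e / 2 / M * M))//; last by rewrite divfK// gt_eqF.
rewrite ler_pM ?lcs_sn_ge0//.
- exact: normc_ge0.
- by rewrite (le_trans (ltW cc'))// ge_min lexx orbT.
- by rewrite ltW// uM.
Qed.

Lemma lcs_locally_convex : exists2 B : set_system V,
  (forall b, b \in B -> convex_set b) & basis B.
Proof.
pose U D (e : R) v : set V := [set w | exists2 d : R, d < e &
  forall q, D q -> lcs_sn q (w - v) <= d].
exists [set b | exists D e v, finite_set D /\ b = U D e v].
  move=> b; rewrite inE => -[D [e [v [_ ->]]]] x y l; rewrite !inE.
  move=> [d de xd] [d' d'e yd']; exists (Num.max d d').
    by rewrite gt_max de d'e.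
  move=> q Dq; set a : R[i] := l%:num.
  have a0 : 0 <= a by rewrite /a.
  have a1 : 0 <= 1 - a by rewrite subr_ge0 /a.
  rewrite [X in lcs_sn q X](_ : _ = a *: ((x : V) - v) + (1 - a) *: ((y : V) - v)).
    rewrite (le_trans (lcs_snD _ _ _))// !lcs_snZ.
    have ab : Normc.normc a + Normc.normc (1 - a) = 1.
      apply: complexI; rewrite rmorphD/= !normc_normr !ger0_norm//.
      by rewrite addrC subrK.
    rewrite -[leRHS]mul1r -ab mulrDl lerD// ler_wpM2l ?normc_ge0//.
      by rewrite le_max (xd q Dq).
    by rewrite le_max (yd' q Dq) orbT.
  rewrite !scalerBr addrACA -opprD -scalerDl.
  by rewrite [a + _]addrC subrK scale1r.
split.
  move=> b [D [e [v [Df ->]]]]; rewrite openE => w [d de wd].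
  exists D, ((e - d) / 2); split; rewrite ?divr_gt0 ?subr_gt0//.
  move=> u wu; exists (d + (e - d) / 2).
    by rewrite -ltrBrDl gtr_pMr ?subr_gt0// invf_lt1// ltr1n.
  move=> q Dq; rewrite (le_trans (lcs_sn_sub _ _ w _))// addrC lerD ?wd//.
  by rewrite ltW// wu.
move=> v A [D [e [Df e0 DA]]].
exists (U D e v) => /=; first split.
- by exists D, e, v.
- by exists 0 => // q _; rewrite subrr lcs_sn0.
by move=> w [d de wd]; apply: DA => q Dq; exact: le_lt_trans (wd q Dq) de.
Qed.

Lemma lcs_hausdorff : hausdorff_space V.
Proof.
move=> u v uv; apply/eqP; rewrite -subr_eq0; apply/eqP; apply: lcs_sep => q.
apply/eqP; rewrite eq_le lcs_sn_ge0 andbT leNgt; apply/negP => uv0.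
pose d := lcs_sn q (u - v) / 2; have d0 : 0 < d by rewrite divr_gt0.
have nb (w : V) : nbhs w (lcs_ball [set q] d w).
  by exists [set q], d; split => //; exact: finite_set1.
have [w [/(_ q erefl) uw /(_ q erefl) vw]] := uv _ _ (nb u) (nb v).
have := lcs_sn_sub q u w v; rewrite leNgt => /negP; apply.
rewrite [ltRHS]splitr ltrD// -lcs_snN opprB; exact: uw.
Qed.

End lcs_tvs.

HB.instance Definition _ (R : realType) (V : lcs R) :=
  PreTopologicalLmod_isTvs.Build R[i] (lcs_space V) (@lcs_add_continuous R V)
    (@lcs_scale_continuous R V) (@lcs_locally_convex R V).
(* The factory [PreTopologicalLmod_isTvs] only produces the uniform structure. *)
HB.instance Definition _ (R : realType) (V : lcs R) :=
  PreTopologicalNmodule_isTopologicalNmodule.Build (lcs_space V)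
    (@lcs_add_continuous R V).
HB.instance Definition _ (R : realType) (V : lcs R) :=
  TopologicalNmodule_isTopologicalLmodule.Build R[i] (lcs_space V)
    (@lcs_scale_continuous R V).
HB.instance Definition _ (R : realType) (V : lcs R) :=
  Uniform_isTvs.Build R[i] (lcs_space V) (@lcs_locally_convex R V).

Definition multi_index (n : nat) := {ffun 'I_n -> nat}.

Definition mi_abs n (mu : multi_index n) : nat := (\sum_(i < n) mu i)%N.

(* The order in which the partial derivatives in d^mu are composed. *)
Definition mi_seq n (mu : multi_index n) : seq 'I_n :=
  flatten [seq nseq (mu i) i | i <- enum 'I_n].

(* 1 + ||x||^2 for the Euclidean norm; the library's norm on row vectors is the
   maximum norm.                                                              *)
Definition jbr (R : realType) (n : nat) (x : 'rV[R]_n) : R :=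
  1 + \sum_(i < n) x 0 i ^+ 2.

Section smooth_tvs.
Variables (R : realType) (n : nat) (W : tvsType R[i]).
Implicit Types (F G : 'rV[R]_n -> W) (x : 'rV[R]_n) (i : 'I_n) (s : seq 'I_n).

(* The library's ['D_v f] needs source and target to be normed modules over the
   same field; here R^n is real and W is a complex tvs.  As [tvsType] is not
   pointed, the limit is taken with [xget] instead of [lim].                  *)
Definition diffquot F x i (h : R) : W :=
  (h^-1)%:C%C *: (F (x + h *: delta_mx 0 i) - F x).

Definition pderivable F x i := exists l : W, diffquot F x i h @[h --> 0^'] --> l.

Definition pderive i F x : W :=
  xget 0 [set l : W | diffquot F x i h @[h --> 0^'] --> l].

Definition pderives s F : 'rV[R]_n -> W := foldr pderive F s.

Definition pd (mu : multi_index n) F := pderives (mi_seq mu) F.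

Definition smooth F := forall s,
  continuous (pderives s F) /\ forall x i, pderivable (pderives s F) x i.

Hypothesis hW : hausdorff_space W.

Lemma pderiveP F x i (l : W) :
  diffquot F x i h @[h --> 0^'] --> l -> pderive i F x = l.
Proof.
by move=> Fl; apply: xget_unique => // l' Fl'; exact: (cvg_unique hW Fl' Fl).
Qed.

Lemma pderive_cvg F x i :
  pderivable F x i -> diffquot F x i h @[h --> 0^'] --> pderive i F x.
Proof. by move=> [l Fl]; rewrite (pderiveP Fl). Qed.

Lemma cvg_lin (T : Type) (f g : T -> W) (c : R[i]) (a b : W)
    (Fil : set_system T) : Filter Fil ->
  f t @[t --> Fil] --> a -> g t @[t --> Fil] --> b ->
  (c *: f t + g t) @[t --> Fil] --> c *: a + b.
Proof.
move=> FF fa gb.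
apply: (@cvg_comp _ _ _ (fun t => (c *: f t, g t)) (fun z : W * W => z.1 + z.2));
  last exact: (@add_continuous W (c *: a, b)).
apply: cvg_pair => //.
apply: (@cvg_comp _ _ _ (fun t => (c, f t)) (fun z : R[i]^o * W => z.1 *: z.2));
  last exact: (@scale_continuous _ W (c, a)).
by apply: (@cvg_pair _ _ _ _ (nbhs (c : R[i]^o))) => //; exact: cvg_cst.
Qed.

Lemma diffquot_lin c F G x i : pderivable F x i -> pderivable G x i ->
  diffquot (c *: F + G) x i h @[h --> 0^'] --> c *: pderive i F x + pderive i G x.
Proof.
move=> Fx Gx.
have -> : diffquot (c *: F + G) x i =
    fun h => c *: diffquot F x i h + diffquot G x i h.
  apply/funext => h; rewrite /diffquot !fctE /= opprD addrACA -scalerBr scalerDr.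
  by rewrite !scalerA mulrC.
by apply: cvg_lin; exact: pderive_cvg.
Qed.

Lemma pderives_lin c F G s : smooth F -> smooth G ->
  pderives s (c *: F + G) = c *: pderives s F + pderives s G.
Proof.
move=> sF sG; elim: s => //= i s ->; apply/funext => x.
by apply/pderiveP/diffquot_lin; [case: (sF s)|case: (sG s)].
Qed.

Lemma smooth_lin c F G : smooth F -> smooth G -> smooth (c *: F + G).
Proof.
move=> sF sG s; rewrite pderives_lin//.
have [cF dF] := sF s; have [cG dG] := sG s; split.
  by move=> x; apply: (@cvg_lin _ _ _ c _ _ _ _ (cF x) (cG x)).
move=> x i; exists (c *: pderive i (pderives s F) x + pderive i (pderives s G) x).
exact: diffquot_lin.
Qed.

Lemma diffquot0 x i :
  diffquot (0 : 'rV[R]_n -> W) x i h @[h --> 0^'] --> (0 : W).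
Proof.
have -> : diffquot (0 : 'rV[R]_n -> W) x i = fun=> 0.
  by apply/funext => h; rewrite /diffquot subrr scaler0.
exact: cvg_cst.
Qed.

Lemma pderives0 s : pderives s (0 : 'rV[R]_n -> W) = 0.
Proof.
by elim: s => //= i s ->; apply/funext => x; exact/pderiveP/diffquot0.
Qed.

Lemma smooth0 : smooth 0.
Proof.
move=> s; rewrite pderives0; split; first exact: cst_continuous.
by move=> x i; exists 0; exact: diffquot0.
Qed.

Lemma pderivesZ c F s : smooth F -> pderives s (c *: F) = c *: pderives s F.
Proof.
by move=> sF; have := pderives_lin c s sF smooth0; rewrite pderives0 !addr0.
Qed.

Lemma pd0 F : pd [ffun=> 0%N] F = F.
Proof.
rewrite /pd /mi_seq; suff -> : flatten
  [seq nseq ([ffun=> 0%N] i) i | i <- enum 'I_n] = [::] by [].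
by elim: (enum _) => //= i s ->; rewrite ffunE.
Qed.

End smooth_tvs.

Section sup_seminorm.
Variables (R : realType) (T : Type) (A : set T).
Implicit Types f g h : T -> R.

Lemma sup_leD f g h : has_ubound [set f t | t in A] ->
  has_ubound [set g t | t in A] -> (forall t, A t -> h t <= f t + g t) ->
  sup [set h t | t in A] <= sup [set f t | t in A] + sup [set g t | t in A].
Proof.
move=> fb gb hfg; have [->|/set0P[t0 At0]] := eqVneq A set0.
  by rewrite !image_set0 sup0 addr0.
apply: ge_sup; first by exists (h t0), t0.
move=> _ [t At <-]; rewrite (le_trans (hfg t At))// lerD//.
  by apply: ub_le_sup => //; exists t.
by apply: ub_le_sup => //; exists t.
Qed.

Lemma sup_scale f (c : R) : 0 <= c -> has_ubound [set f t | t in A] ->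
  sup [set c * f t | t in A] = c * sup [set f t | t in A].
Proof.
move=> c0 fb; have [->|/set0P[t0 At0]] := eqVneq A set0.
  by rewrite !image_set0 sup0 mulr0.
have ub : ubound [set c * f t | t in A] (c * sup [set f t | t in A]).
  by move=> _ [t At <-]; rewrite ler_wpM2l//; apply: ub_le_sup => //; exists t.
apply/eqP; rewrite eq_le; apply/andP; split.
  by apply: ge_sup => //; exists (c * f t0), t0.
have [<-|cn0] := eqVneq 0 c; last have {cn0}c0 : 0 < c by rewrite lt_neqAle cn0.
  rewrite mul0r; apply: (@le_trans _ _ (0 * f t0)); first by rewrite mul0r.
  apply: ub_le_sup; last by exists t0.
  by exists 0 => _ [t _ <-]; rewrite mul0r.
rewrite -ler_pdivlMl//; apply: ge_sup; first by exists (f t0), t0.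
move=> _ [t At <-]; rewrite ler_pdivlMl//; apply: ub_le_sup; last by exists t.
by exists (c * sup [set f t | t in A]).
Qed.

Lemma ubound_lin f g h (c : R) : 0 <= c -> has_ubound [set f t | t in A] ->
  has_ubound [set g t | t in A] -> (forall t, A t -> h t <= c * f t + g t) ->
  has_ubound [set h t | t in A].
Proof.
move=> c0 [M fM] [N gN] hfg; exists (c * M + N) => _ [t At <-].
by rewrite (le_trans (hfg t At))// lerD ?ler_wpM2l//; [apply: fM|apply: gN]; exists t.
Qed.

End sup_seminorm.

(* A vector space [fs_mem] of functions R^n -> W with a separating system of
   seminorms, regarded as a locally convex space.                             *)
Record fspace (R : realType) (n : nat) (W : tvsType R[i]) := FSpace {
  fs_mem : set ('rV[R]_n -> W);
  fs_mem0 : fs_mem 0;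
  fs_memL : forall c F G, fs_mem F -> fs_mem G -> fs_mem (c *: F + G);
  fs_idx : Type;
  fs_sn : fs_idx -> ('rV[R]_n -> W) -> R;
  fs_snD : forall k F G, fs_mem F -> fs_mem G ->
    fs_sn k (F + G) <= fs_sn k F + fs_sn k G;
  fs_snZ : forall k c F, fs_mem F ->
    fs_sn k (c *: F) = Normc.normc c * fs_sn k F;
  fs_sep : forall F, fs_mem F -> (forall k, fs_sn k F = 0) -> F = 0 }.

Section fspace_lcs.
Variables (R : realType) (n : nat) (W : tvsType R[i]) (E : fspace n W).

Definition fs_pred : {pred 'rV[R]_n -> W} := fun F => `[< fs_mem E F >].

Record fs_elt := FsElt { fs_val : 'rV[R]_n -> W; fs_valP : fs_val \in fs_pred }.

HB.instance Definition _ := [isSub for fs_val].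
HB.instance Definition _ := [Choice of fs_elt by <:].

Lemma fs_submod_closed : submod_closed fs_pred.
Proof.
split; first by apply/asboolP; exact: fs_mem0.
by move=> c F G /asboolP FE /asboolP GE; apply/asboolP; exact: fs_memL.
Qed.

HB.instance Definition _ := GRing.SubChoice_isSubLmodule.Build R[i]
  ('rV[R]_n -> W) fs_pred fs_elt fs_submod_closed.

Lemma fs_val_mem (f : fs_elt) : fs_mem E (fs_val f).
Proof. by apply/asboolP; exact: fs_valP. Qed.

Lemma fs_elt_snD (k : fs_idx E) (f g : fs_elt) :
  fs_sn k (fs_val (f + g)) <= fs_sn k (fs_val f) + fs_sn k (fs_val g).
Proof. exact: fs_snD (fs_val_mem f) (fs_val_mem g). Qed.

Lemma fs_elt_snZ (k : fs_idx E) c (f : fs_elt) :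
  fs_sn k (fs_val (c *: f)) = Normc.normc c * fs_sn k (fs_val f).
Proof. exact: fs_snZ (fs_val_mem f). Qed.

Lemma fs_elt_sep (f : fs_elt) :
  (forall k : fs_idx E, fs_sn k (fs_val f) = 0) -> f = 0.
Proof. by move=> f0; apply: val_inj; exact: fs_sep (fs_val_mem f) f0. Qed.

Definition fs_lcs : lcs R := Lcs fs_elt_snD fs_elt_snZ fs_elt_sep.

End fspace_lcs.

(* Smooth functions F with sup_x w_k(x) p_k(d^{mu_k} F(x)) < oo for all k, with
   these suprema as seminorms.                                                *)
Section weighted_fspace.
Variables (R : realType) (n : nat) (W : tvsType R[i]) (I : Type).
Variables (mu : I -> multi_index n) (w : I -> 'rV[R]_n -> R) (p : I -> W -> R).

Definition weighted_set (k : I) (F : 'rV[R]_n -> W) : set R :=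
  [set w k x * p k (pd (mu k) F x) | x in [set: 'rV[R]_n]].

Definition weighted_mem (F : 'rV[R]_n -> W) : Prop :=
  smooth F /\ forall k, has_ubound (weighted_set k F).

Definition weighted_sn (k : I) (F : 'rV[R]_n -> W) : R := sup (weighted_set k F).

Hypothesis hW : hausdorff_space W.
Hypothesis w_gt0 : forall k x, 0 < w k x.
Hypothesis p_ge0 : forall k u, 0 <= p k u.
Hypothesis pD : forall k u v, p k (u + v) <= p k u + p k v.
Hypothesis pZ : forall k c u, p k (c *: u) = Normc.normc c * p k u.
Hypothesis p_sep : forall u,
  (forall k, mu k = [ffun=> 0%N] -> p k u = 0) -> u = 0.

Lemma weighted_mem0 : weighted_mem 0.
Proof.
split; first exact: smooth0.
move=> k; exists 0 => _ [x _ <-]; rewrite /pd pderives0//.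
have -> : p k 0 = 0 by rewrite -(scale0r 0) pZ Normc.normc0 mul0r.
by rewrite mulr0.
Qed.

Lemma weighted_memL c F G :
  weighted_mem F -> weighted_mem G -> weighted_mem (c *: F + G).
Proof.
move=> [sF bF] [sG bG]; split; first exact: smooth_lin.
move=> k; apply: (ubound_lin (normc_ge0 c)); [exact: bF|exact: bG|] => x _.
rewrite /pd pderives_lin// mulrCA -mulrDr ler_wpM2l ?(ltW (w_gt0 _ _))//.
by rewrite -pZ pD.
Qed.

Lemma weighted_snD k F G : weighted_mem F -> weighted_mem G ->
  weighted_sn k (F + G) <= weighted_sn k F + weighted_sn k G.
Proof.
move=> [sF bF] [sG bG]; apply: sup_leD; [exact: bF|exact: bG|] => x _.
have := pderives_lin hW 1 (mi_seq (mu k)) sF sG; rewrite !scale1r /pd => ->.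
by rewrite -mulrDr ler_wpM2l ?(ltW (w_gt0 _ _))// pD.
Qed.

Lemma weighted_snZ k c F : weighted_mem F ->
  weighted_sn k (c *: F) = Normc.normc c * weighted_sn k F.
Proof.
move=> [sF bF]; rewrite -(sup_scale (normc_ge0 c) (bF k)); congr sup.
by apply: eq_imagel => x _; rewrite /pd pderivesZ// mulrCA -pZ.
Qed.

Lemma weighted_sep F : weighted_mem F -> (forall k, weighted_sn k F = 0) -> F = 0.
Proof.
move=> [sF bF] F0; apply/funext => x; apply: p_sep => k k0.
have : w k x * p k (F x) <= 0.
  rewrite -(F0 k); apply: ub_le_sup => //; exists x => //.
  by rewrite k0 pd0.
by rewrite pmulr_rle0// => pF; apply/eqP; rewrite eq_le pF p_ge0.
Qed.

Definition weighted_fspace : fspace n W :=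
  FSpace weighted_mem0 weighted_memL weighted_snD weighted_snZ weighted_sep.

End weighted_fspace.

Section function_spaces.
Variables (R : realType) (n : nat).

Lemma jbr_gt0 (x : 'rV[R]_n) : 0 < jbr x.
Proof. by rewrite ltr_pwDl// sumr_ge0// => i _; rewrite sqr_ge0. Qed.

Lemma jbr_powR_gt0 (x : 'rV[R]_n) (a : R) : 0 < jbr x `^ a.
Proof. exact/powR_gt0/jbr_gt0. Qed.

Lemma C_hausdorff : hausdorff_space R[i]^o.
Proof. exact: norm_hausdorff. Qed.

Lemma normcD (u v : R[i]^o) :
  Normc.normc (u + v) <= Normc.normc u + Normc.normc v.
Proof. exact: le_normcD. Qed.

Lemma normcZ (c : R[i]) (u : R[i]^o) :
  Normc.normc (c *: u) = Normc.normc c * Normc.normc u.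
Proof. exact: Normc.normcM. Qed.

Lemma lcs_sep0 (V : lcs R) (u : V) :
  (forall k : lcs_idx V * multi_index n, k.2 = [ffun=> 0%N] ->
    lcs_sn k.1 u = 0) -> u = 0.
Proof. by move=> u0; apply: lcs_sep => q; exact: (u0 (q, [ffun=> 0%N])). Qed.

Lemma normc_sep0 (I : Type) (mu : I -> multi_index n) (k0 : I) (u : R[i]^o) :
  mu k0 = [ffun=> 0%N] ->
  (forall k, mu k = [ffun=> 0%N] -> Normc.normc u = 0) -> u = 0.
Proof. by move=> mu0 /(_ k0 mu0) /Normc.eq0_normc. Qed.

(* S^{m,0}(R^n, V) for an order m of the defining system of V; its seminorms
   are indexed by the pairs (q, mu).                                          *)
Definition vsymbol_fspace (V : lcs R) (m : lcs_idx V -> R) :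
    @fspace R n (lcs_space V) :=
  @weighted_fspace R n (lcs_space V) (lcs_idx V * multi_index n)
    (fun k => k.2) (fun k x => jbr x `^ (- m k.1 / 2)) (fun k v => lcs_sn k.1 v)
    (@lcs_hausdorff R V) (fun k x => jbr_powR_gt0 x _)
    (fun k => @lcs_sn_ge0 R V k.1) (fun k => @lcs_snD R V k.1)
    (fun k => @lcs_snZ R V k.1) (@lcs_sep0 V).

Definition symbol_fspace (m rho : R) : @fspace R n R[i]^o :=
  @weighted_fspace R n R[i]^o (multi_index n) id
    (fun mu x => jbr x `^ (- (m - rho * (mi_abs mu)%:R) / 2))
    (fun _ => @Normc.normc R)
    C_hausdorff (fun k x => jbr_powR_gt0 x _) (fun=> @normc_ge0 R)
    (fun=> normcD) (fun=> normcZ) (fun u => @normc_sep0 _ id _ u erefl).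

Definition schwartz_fspace : @fspace R n R[i]^o :=
  @weighted_fspace R n R[i]^o (nat * multi_index n) (fun k => k.2)
    (fun k x => jbr x `^ (k.1%:R / 2)) (fun _ => @Normc.normc R)
    C_hausdorff (fun k x => jbr_powR_gt0 x _) (fun=> @normc_ge0 R)
    (fun=> normcD) (fun=> normcZ)
    (fun u => @normc_sep0 _ (fun k => k.2) (0%N, _) u erefl).

(* p_{J,l} is a supremum over the pairs (x, mu) with x in J and |mu| <= l. *)
Definition Cinf_dom (k : {J : set 'rV[R]_n | compact J} * nat) :
    set ('rV[R]_n * multi_index n) :=
  [set t | sval k.1 t.1 /\ (mi_abs t.2 <= k.2)%N].

Definition Cinf_sn (k : {J : set 'rV[R]_n | compact J} * nat)
    (f : 'rV[R]_n -> R[i]^o) : R :=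
  sup [set Normc.normc (pd t.2 f t.1) | t in Cinf_dom k].

Lemma normc_continuous : continuous (@Normc.normc R : R[i]^o -> R).
Proof.
move=> u A /nbhs_ballP[e /= e0 eA].
apply/(@nbhs_ballP _ R[i]^o); exists e%:C%C => [|v uv]; first by rewrite /= ltcR.
apply: eA; rewrite -ball_normE /=.
rewrite -ball_normE /= in uv; apply: le_lt_trans (_ : Normc.normc (u - v) < e); last first.
  by rewrite -ltcR normc_normr.
have D (a b : R[i]^o) : Normc.normc a - Normc.normc b <= Normc.normc (a - b).
  by rewrite lerBlDr; have := normcD (a - b) b; rewrite subrK.
rewrite ler_norml lerNl opprB D andbT.
by rewrite -(normcN (u - v)) opprB D.
Qed.

Lemma Cinf_ubound k (f : 'rV[R]_n -> R[i]^o) : smooth f ->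
  has_ubound [set Normc.normc (pd t.2 f t.1) | t in Cinf_dom k].
Proof.
move=> sf; case: k => -[J cJ] l.
have bmu mu : exists M : R, 0 <= M /\ forall x, J x -> Normc.normc (pd mu f x) <= M.
  have [->|/set0P J0] := eqVneq J set0; first by exists 0.
  have cf : {within J, continuous (fun x => Normc.normc (pd mu f x))}.
    apply: continuous_subspaceT => x; apply: continuous_comp.
      exact: (sf (mi_seq mu)).1.
    exact: normc_continuous.
  have /compact_has_sup : [set Normc.normc (pd mu f x) | x in J] !=set0.
    by move: J0 => [x Jx]; exists (Normc.normc (pd mu f x)), x.
  move=> /(_ (continuous_compact cf cJ))[_ [M JM]].
  move: (J0) => [x0 Jx0]; exists M; split.
    have /JM : [set Normc.normc (pd mu f x) | x in J] (Normc.normc (pd mu f x0)).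
      by exists x0.
    exact/le_trans/normc_ge0.
  by move=> x Jx; apply: JM; exists x.
pose emb (g : {ffun 'I_n -> 'I_l.+1}) : multi_index n := [ffun i => g i : nat].
have /choice[M MP] : forall g, exists M : R,
    0 <= M /\ forall x, J x -> Normc.normc (pd (emb g) f x) <= M.
  by move=> g; exact: bmu.
exists (\sum_g M g) => _ [[x mu] /= [Jx mul] <-].
have mu_le i : (mu i < l.+1)%N.
  by rewrite ltnS (leq_trans _ mul)// /mi_abs (bigD1 i)//= leq_addr.
have -> : mu = emb [ffun i => Ordinal (mu_le i)].
  by apply/ffunP => i; rewrite !ffunE.
rewrite (le_trans ((MP _).2 x Jx))// (bigD1 [ffun i => Ordinal (mu_le i)])//=.
by rewrite lerDl sumr_ge0// => g _; exact: (MP g).1.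
Qed.

Lemma Cinf_snD k (f g : 'rV[R]_n -> R[i]^o) : smooth f -> smooth g ->
  Cinf_sn k (f + g) <= Cinf_sn k f + Cinf_sn k g.
Proof.
move=> sf sg; apply: sup_leD; [exact: Cinf_ubound|exact: Cinf_ubound|].
move=> t _; have := pderives_lin C_hausdorff 1 (mi_seq t.2) sf sg.
by rewrite !scale1r /pd => ->; exact: normcD.
Qed.

Lemma Cinf_snZ k (c : R[i]) (f : 'rV[R]_n -> R[i]^o) : smooth f ->
  Cinf_sn k (c *: f) = Normc.normc c * Cinf_sn k f.
Proof.
move=> sf; rewrite /Cinf_sn -(sup_scale (normc_ge0 c) (Cinf_ubound k sf)).
congr sup; apply: eq_imagel => t _; rewrite /pd (pderivesZ C_hausdorff c _ sf).
exact: normcZ.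
Qed.

Lemma Cinf_sep (f : 'rV[R]_n -> R[i]^o) : smooth f ->
  (forall k, Cinf_sn k f = 0) -> f = 0.
Proof.
move=> sf f0; apply/funext => x; apply: Normc.eq0_normc.
pose k : {J : set 'rV[R]_n | compact J} * nat :=
  (exist _ [set x] (@compact_set1 _ x), 0%N).
apply/eqP; rewrite eq_le normc_ge0 andbT -(f0 k).
apply: ub_le_sup; first exact: Cinf_ubound.
exists (x, [ffun=> 0%N]); last by rewrite /= pd0.
by split => //=; rewrite /mi_abs big1// => i _; exact: ffunE.
Qed.

Definition Cinf_fspace : @fspace R n R[i]^o :=
  @FSpace R n R[i]^o (@smooth R n R[i]^o) (smooth0 C_hausdorff)
    (fun c F G => @smooth_lin R n R[i]^o C_hausdorff c F G) _ Cinf_sn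
    Cinf_snD Cinf_snZ Cinf_sep.

End function_spaces.

Coercion fs_lcs : fspace >-> lcs.

Definition fs_fun (R : realType) (n : nat) (W : tvsType R[i]) (E : fspace n W)
  (f : fs_lcs E) : 'rV[R]_n -> W := @fs_val R n W E f.

(* The last clause says both that alpha(v) : x |-> alpha_x(v) lies in
   S^{m,0}(R^n, V) for each v and that v |-> alpha(v) is continuous.          *)
Definition polybounded_action (R : realType) (n : nat) (V : lcs R)
    (m : lcs_idx V -> R) (alpha : 'rV[R]_n -> V -> V) : Prop :=
  [/\ forall x (c : R[i]) (u v : V),
        alpha x (c *: u + v) = c *: alpha x u + alpha x v,
      forall v, alpha 0 v = v,
      forall x x' v, alpha x (alpha x' v) = alpha (x + x') v
    & exists2 A : V -> vsymbol_fspace n m,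
        forall v x, fs_fun (A v) x = alpha x v & continuous A].

Section compact_action.
Variables (R : realType) (n : nat).

(* Iterated directional derivatives along vectors e_i; f is C^oo when e is a
   basis and all of them exist and are continuous.                            *)
Definition rpderives (U W : normedModType R) (I : Type) (e : I -> U) (s : seq I)
  (f : U -> W) : U -> W := foldr (fun i g => 'D_(e i) g) f s.

Definition rsmooth (U W : normedModType R) (I : Type) (e : I -> U)
    (f : U -> W) : Prop := forall s,
  continuous (rpderives e s f) /\
  forall x i, derivable (rpderives e s f) x (e i).

Definition coord (i : 'I_n) : 'rV[R]_n := delta_mx 0 i.

Definition coord2 (i : 'I_n + 'I_n) : 'rV[R]_n * 'rV[R]_n :=
  match i with inl i => (coord i, 0) | inr j => (0, coord j) end.

Definition rpd (mu : multi_index n) (f : 'rV[R]_n -> R) : 'rV[R]_n -> R :=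
  rpderives coord (mi_seq mu) f.

Definition smooth_compact_action (K : set 'rV[R]_n) (b : nat -> R)
    (tau : 'rV[R]_n -> 'rV[R]_n -> 'rV[R]_n) : Prop :=
  [/\ rsmooth coord2 (fun z : 'rV[R]_n * 'rV[R]_n => tau z.1 z.2),
      (forall y, tau 0 y = y) /\
        (forall x x' y, tau x (tau x' y) = tau (x + x') y),
      forall x y, ~ K y -> tau x y = y
    & forall (mu : multi_index n) (l : nat), exists2 c : R, 0 < c &
        forall (x y : 'rV[R]_n) (nu : multi_index n) (j : 'I_n),
          K y -> (mi_abs nu <= l)%N ->
          `| rpd nu (fun y' => rpd mu (fun x' => tau x' y' 0 j) x) y |
            <= c * jbr x `^ (b l / 2)].

End compact_action.

(* f |-> f o tau_x maps E into itself and is a polynomially bounded action. *)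
Definition pullback_polybounded (R : realType) (n : nat) (W : tvsType R[i])
    (tau : 'rV[R]_n -> 'rV[R]_n -> 'rV[R]_n) (E : fspace n W) : Prop :=
  exists alpha : 'rV[R]_n -> E -> E,
    (forall x (f : E) y, fs_fun (alpha x f) y = fs_fun f (tau x y)) /\
    exists m : lcs_idx E -> R, polybounded_action m alpha.

(* Main.v *)
Require Import Defs.
From mathcomp Require Import all_boot all_order all_algebra.
From mathcomp Require Import all_classical all_reals all_analysis.
From mathcomp Require Import complex ring.

(* Writing X_i for the vector field d/dx_i tau_x at x = 0, the group law gives
   d_{x_i} (f o tau_x) = (X_i f) o tau_x, so that every x-derivative of the
   orbit x |-> f o tau_x is again an orbit.  Hence no x-derivative of tau has to
   be controlled for large x, and the order of growth, which comes from the
   y-derivatives of f o tau_x through the chain rule, is the same for all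
   x-derivatives.  As f o tau_x - f is supported in K, the difference quotients
   at x = 0 converge in the topology of each of the three function spaces as
   soon as all their y-derivatives converge uniformly on K, which follows from
   the mean value theorem and the compactness of K.                           *)

Set Implicit Arguments.
Unset Strict Implicit.
Unset Printing Implicit Defensive.

Import Order.TTheory GRing.Theory Num.Theory.
Import numFieldNormedType.Exports.

Local Open Scope classical_set_scope.
Local Open Scope ring_scope.

(** * Calculus along lines *)

(** The three spaces enter only through [local_on]. Since tau_x maps K into itself, the jets of f o
    tau_x on K depend only on the jets of f on K, and off K nothing changes. The weights, which
    differ from space to space, therefore matter only on K, where they are comparable to constants,
    and never meet the chain rule. One step of the chain rule, from order k to k+1, costs a factor
    affine in the (k+1)-jet of tau_x, of growth b_{k+1}; a seminorm involving derivatives up to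
    order l on K thus gets the order b_1 + ... + b_l. Limits at an arbitrary x reduce to limits at
    0: the difference quotient of the orbit at x is the pullback by tau_x of the quotient at 0, and
    this pullback is continuous. Smoothness speaks of partial derivatives composed in any order, the
    seminorms of one fixed order; symmetry of mixed derivatives reconciles the two and lets d/dx_i
    pass through the y-derivatives of a difference quotient. *)

Lemma is_derive_affine (R : numFieldType) (U V W : normedModType R)
    (f : V -> W) (p : U -> V) (u v : U) (w : V) :
  (forall h : R, p (h *: v + u) = h *: w + p u) -> derivable f (p u) w ->
  is_derive u v (f \o p) ('D_w f (p u)).
Proof.
move=> pE df.
have E : (fun h : R => h^-1 *: (((f \o p) \o shift u) (h *: v) - (f \o p) u)) =
         (fun h => h^-1 *: ((f \o shift (p u)) (h *: w) - f (p u))).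
  by apply/funext => h /=; rewrite pE.
by split; [rewrite /derivable E|rewrite /derive E].
Qed.

Section lines.
Variables (R : realType) (U : normedModType R).
Implicit Types (f : U -> R) (u v a b : U).

Lemma is_derive_line f u v (t : R) : derivable f (u + t *: v) v ->
  is_derive t 1 (fun t => f (u + t *: v)) ('D_v f (u + t *: v)).
Proof.
move=> df; refine (@is_derive_affine R R U R f (fun t => u + t *: v)
  t 1 v _ df) => h.
by rewrite [h *: 1]mulr1 scalerDl addrCA.
Qed.

Lemma MVT_line f u v (h : R) : (forall x, derivable f x v) ->
  exists2 t, `|t| <= `|h| & f (u + h *: v) - f u = h * 'D_v f (u + t *: v).
Proof.
move=> df; pose phi t := f (u + t *: v).
have dphi (t : R) : is_derive t 1 phi ('D_v f (u + t *: v)).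
  exact: is_derive_line.
have cphi (A : set R) : {within A, continuous phi}.
  apply: continuous_subspaceT => t.
  by apply/differentiable_continuous/derivable1_diffP; case: (dphi t).
have phi0 : phi 0 = f u by rewrite /phi scale0r addr0.
have [h0|h0] := leP 0 h.
  have [t] := MVT_segment h0 (fun t _ => dphi t) (cphi _).
  rewrite in_itv /= phi0 subr0 => /andP[t0 th] E.
  by exists t; [rewrite !ger0_norm|rewrite -/(phi h) E mulrC].
have [t] := MVT_segment (ltW h0) (fun t _ => dphi t) (cphi _).
rewrite in_itv /= phi0 sub0r => /andP[th t0] E.
exists t; first by rewrite !ler0_norm ?lerN2// ltW.
by rewrite -/(phi h) -opprB E mulrN opprK mulrC.
Qed.

Lemma is_derive_translate f c u v : derivable f (u + c) v ->
  is_derive u v (fun x => f (x + c)) ('D_v f (u + c)).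
Proof.
move=> df; apply: (@is_derive_affine _ _ _ _ f (+%R^~ c)) => // h.
by rewrite addrA.
Qed.

(** The mean value theorem is applied to x |-> f (x + h b) - f x in direction a, then to ['D_a f] in
    direction b. *)
Lemma second_difference f a b u (h : R) :
  (forall x, derivable f x a) -> (forall x, derivable ('D_a f) x b) ->
  exists p q, [/\ `|p| <= `|h|, `|q| <= `|h| &
    f (u + h *: a + h *: b) - f (u + h *: a) - (f (u + h *: b) - f u) =
    h * (h * 'D_b ('D_a f) (u + p *: a + q *: b))].
Proof.
move=> dfa dfab; pose g x := f (x + h *: b) - f x.
have dg x : is_derive x a g ('D_a f (x + h *: b) - 'D_a f x).
  apply: (@is_deriveB _ _ _ (fun x => f (x + h *: b)) f).
    exact/is_derive_translate/dfa.
  exact: derivableP.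
have [p ph E] := MVT_line u h (fun x => @ex_derive _ _ _ _ _ _ _ (dg x)).
have [q qh E2] := MVT_line (u + p *: a) h dfab.
exists p, q; split => //.
by rewrite -E2 -(@derive_val _ _ _ _ _ _ _ (dg (u + p *: a))) -E /g.
Qed.

Lemma continuous_plane (g : U -> R) u a b (e : R) : {for u, continuous g} ->
  0 < e -> exists2 d : R, 0 < d & forall p q : R, `|p| <= d -> `|q| <= d ->
    `|g (u + p *: a + q *: b) - g u| < e.
Proof.
move=> cg e0.
have /cvgrPdist_lt /(_ e e0) /nbhs_ballP[r /= r0 gr] := cg.
have N0 : 0 < `|a| + `|b| + 1 by rewrite ltr_wpDl// addr_ge0.
(* The [+ 1] keeps the divisor positive when a = b = 0; the half turns the non-strict bounds on p
   and q into membership in the open ball of radius r. *)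
exists (r / 2 / (`|a| + `|b| + 1)); first by rewrite !divr_gt0.
move=> p q pd qd; rewrite distrC; apply: gr.
rewrite -ball_normE /= -addrA opprD addNKr normrN.
rewrite (le_lt_trans (ler_normD _ _))// !normrZ.
apply: (@le_lt_trans _ _ (r / 2 / (`|a| + `|b| + 1) * (`|a| + `|b| + 1))).
  by rewrite 2!mulrDr -[leLHS]addr0 !lerD ?ler_wpM2r// mulr_ge0// !divr_ge0// ltW.
by rewrite divfK ?gt_eqF// ltr_pdivrMr// ltr_pMr// ltr1n.
Qed.

(* Both iterated derivatives are limits of the same second difference
   quotient.                                                                  *)
Lemma derive_comm f a b u :
  (forall x, derivable f x a) -> (forall x, derivable f x b) ->
  (forall x, derivable ('D_a f) x b) -> (forall x, derivable ('D_b f) x a) ->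
  continuous ('D_b ('D_a f)) -> continuous ('D_a ('D_b f)) ->
  'D_b ('D_a f) u = 'D_a ('D_b f) u.
Proof.
move=> dfa dfb dfab dfba cab cba; apply/eqP; rewrite -subr_eq0 -normr_le0 leNgt.
have key (x y z : R) :
    `|z - x| < `|x - y| / 2 -> `|z - y| < `|x - y| / 2 -> False.
  move=> zx zy; have : `|x - y| < `|x - y|; last by rewrite ltxx.
  rewrite [ltRHS]splitr (le_lt_trans (ler_distD z _ _))// ltrD//.
  by rewrite distrC.
apply/negP; set d := `|_| => d0; have d20 : 0 < d / 2 by rewrite divr_gt0.
have [r r0 ab] := continuous_plane a b (cab u) d20.
have [s s0 ba] := continuous_plane b a (cba u) d20.
pose h := Num.min r s; have h0 : 0 < h by rewrite lt_min r0.
have [p [q [ph qh E]]] := second_difference u h dfa dfab.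
have [p' [q' [p'h q'h E']]] := second_difference u h dfb dfba.
(* The second difference is symmetric in a and b. Cancelling h twice gives one number that is a
   value of both iterated derivatives near u, hence closer than d / 2 to each of their values at u,
   which are d apart. *)
have {E'} : h * (h * 'D_b ('D_a f) (u + p *: a + q *: b)) =
            h * (h * 'D_a ('D_b f) (u + p' *: b + q' *: a)).
  apply: etrans (esym E) _; apply: etrans E'; rewrite [u + h *: b + _]addrAC.
  have swap (x y z w : R) : x - y - (z - w) = x - z - (y - w) by ring.
  exact: swap.
move=> /(mulfI (lt0r_neq0 h0)) /(mulfI (lt0r_neq0 h0)) E'.
rewrite (gtr0_norm h0) in ph qh p'h q'h.
have hr : h <= r by rewrite ge_min lexx.
have hs : h <= s by rewrite ge_min lexx orbT.
have Hab := ab p q (le_trans ph hr) (le_trans qh hr).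
have := ba p' q' (le_trans p'h hs) (le_trans q'h hs).
rewrite -E'; exact: key Hab.
Qed.

End lines.

(** * Smooth functions and permutation of partial derivatives *)

Section smooth_general.
Variables (R : realType) (U : normedModType R) (I : eqType) (e : I -> U).
Implicit Types (f g : U -> R) (s t : seq I).

Lemma rpderives_cat (W : normedModType R) s t (f : U -> W) :
  rpderives e (s ++ t) f = rpderives e s (rpderives e t f).
Proof. exact: foldr_cat. Qed.

Lemma rsmooth_rpderives (W : normedModType R) t (f : U -> W) :
  rsmooth e f -> rsmooth e (rpderives e t f).
Proof. by move=> sf s; rewrite -rpderives_cat; exact: sf. Qed.

Lemma rsmooth_derive (W : normedModType R) i (f : U -> W) :
  rsmooth e f -> rsmooth e ('D_(e i) f).
Proof. exact: (@rsmooth_rpderives W [:: i]). Qed.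

Lemma rpderivesC f i j : rsmooth e f ->
  'D_(e i) ('D_(e j) f) = 'D_(e j) ('D_(e i) f).
Proof.
move=> sf; apply/funext => x; apply: derive_comm.
- by move=> y; exact: (sf [::]).2.
- by move=> y; exact: (sf [::]).2.
- by move=> y; exact: (sf [:: j]).2.
- by move=> y; exact: (sf [:: i]).2.
- exact: (sf [:: i; j]).1.
- exact: (sf [:: j; i]).1.
Qed.

Lemma rpderives_move f i s t : rsmooth e f ->
  rpderives e (i :: s ++ t) f = rpderives e (s ++ i :: t) f.
Proof.
move=> sf; elim: s => // j s IH.
transitivity ('D_(e j) (rpderives e (i :: s ++ t) f)); last by rewrite IH.
exact/rpderivesC/rsmooth_rpderives.
Qed.

(** Links words in the partial derivatives, on which inductions run, to multi-indices, for which
    [mi_seq] fixes one word. *)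
Lemma rpderives_perm f s t : rsmooth e f -> perm_eq s t ->
  rpderives e s f = rpderives e t f.
Proof.
move=> sf; elim: s t => [|i s IH] t; first by rewrite perm_sym => /perm_nilP ->.
move=> st; have : i \in t by rewrite -(perm_mem st) mem_head.
move=> /splitPr tE; case: t / tE st => t1 t2.
rewrite perm_sym -[i :: t2]cat1s perm_catCA /= perm_cons perm_sym => /IH E.
by rewrite -rpderives_move//= E.
Qed.

(** Coinduction: a class of continuous derivable functions stable under each partial derivative
    contains all iterated derivatives of its members, so only first derivatives have to be
    computed. *)
Lemma rsmooth_coind (W : normedModType R) (S : (U -> W) -> Prop) :
  (forall F, S F -> [/\ continuous F, forall x i, derivable F x (e i) &
    forall i, S ('D_(e i) F)]) -> forall F, S F -> rsmooth e F.
Proof.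
move=> HS F SF s; have {SF} : S (rpderives e s F).
  by elim: s => //= i s /HS[].
by move=> /HS[].
Qed.

Lemma rsmooth_continuous (W : normedModType R) (f : U -> W) :
  rsmooth e f -> continuous f.
Proof. by move=> /(_ [::])[]. Qed.

Lemma rsmooth_derivable (W : normedModType R) (f : U -> W) x i :
  rsmooth e f -> derivable f x (e i).
Proof. by move=> /(_ [::])[]. Qed.

End smooth_general.

Arguments rsmooth_derivable {R U I e W f} x i.

(** * The chain rule from continuous partial derivatives *)

Section chain_rule.
Variables (R : realType) (n : nat).
Local Notation V := 'rV[R]_n.

(** The vertices x + [cut v k] form the path from x to x + v that changes one coordinate at a
    time. *)
Let cut (v : V) (k : nat) : V := \row_j (if (j < k)%N then v 0 j else 0).

Let cutS (v : V) (k : 'I_n) : cut v k.+1 = cut v k + v 0 k *: Defs.coord R k.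
Proof.
apply/rowP => j; rewrite !mxE eqxx /= ltnS leq_eqVlt val_eqE.
by have [->|jk] := eqVneq j k; rewrite /= ?ltnn ?mulr1 ?add0r// mulr0 addr0.
Qed.

Let mx_norm_le (v : V) (M : R) : 0 <= M ->
  (forall j, `|v 0 j| <= M) -> `|v| <= M.
Proof.
move=> M0 vM; rewrite /Num.Def.normr/= mx_normrE (bigmax_le _ M0)//= => -[i j] _.
by rewrite ord1.
Qed.

Lemma coord_le_norm (v : V) j : `|v 0 j| <= `|v|.
Proof.
by rewrite [leRHS]/Num.Def.normr/= mx_normrE (le_bigmax _ _ (0, j)).
Qed.

(** The increment telescopes along the path of the [cut v k], with the mean value theorem on each
    leg. The intermediate points stay within [|v|] because the norm is the maximum norm: their
    coordinates are coordinates of v, zeros, and one number t bounded by a coordinate of v. They are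
    chosen as functions of v, so that v can later tend to 0. *)
Lemma increment_expansion (F : V -> R) (x : V) :
  (forall y j, derivable F y (Defs.coord R j)) ->
  exists p : 'I_n -> V -> V, (forall j v, `|p j v| <= `|v|) /\
    forall v, F (x + v) - F x = \sum_j v 0 j * 'D_(Defs.coord R j) F (x + p j v).
Proof.
move=> dF.
have /choice[p pP] (z : 'I_n * V) : exists y : V, `|y| <= `|z.2| /\
    F (x + cut z.2 z.1.+1) - F (x + cut z.2 z.1) =
    z.2 0 z.1 * 'D_(Defs.coord R z.1) F (x + y).
  case: z => j v /=.
  have [t tv] := MVT_line (x + cut v j) (v 0 j) (fun y => dF y j).
  rewrite cutS addrA => ->; exists (cut v j + t *: Defs.coord R j).
  rewrite addrA; split => //.
  apply: mx_norm_le => // k; rewrite !mxE eqxx /=.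
  have [<-|kj] := eqVneq j k.
    by rewrite ltnn add0r mulr1 (le_trans tv)// coord_le_norm.
  by rewrite mulr0 addr0; case: ifP => _; rewrite ?normr0// coord_le_norm.
exists (fun j v => p (j, v)); split; first by move=> j v; have [] := pP (j, v).
move=> v; under eq_bigr => j _ do rewrite -(pP (j, v)).2 /=.
rewrite -(big_mkord xpredT (fun j => F (x + cut v j.+1) - F (x + cut v j))).
rewrite telescope_sumr//; congr (F _ - F _).
  by congr (_ + _); apply/rowP => j; rewrite mxE ltn_ord.
by rewrite (_ : cut v 0 = 0) ?addr0//; apply/rowP => j; rewrite !mxE.
Qed.

(** Dividing [increment_expansion] by h leaves the partials of F at points tending to g u, times the
    difference quotients of the entries of g. Continuity of the partials takes the place of total
    differentiability of F; derivability of g along w makes its increment v tend to 0. *)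
Lemma is_derive_comp_partials (U : normedModType R) (F : V -> R) (g : U -> V) u w :
  (forall y j, derivable F y (Defs.coord R j)) ->
  (forall j, continuous ('D_(Defs.coord R j) F)) -> derivable g u w ->
  is_derive u w (F \o g) (\sum_j 'D_(Defs.coord R j) F (g u) * ('D_w g u) 0 j).
Proof.
move=> dF cF dg.
have [p [pv pE]] := increment_expansion (g u) dF.
pose v (h : R) : V := g (h *: w + u) - g u.
have v0 : v @ 0^' --> (0 : V).
  suff : {for 0, continuous (fun h : R => g (h *: w + u))}.
    move=> /continuous_withinNx; rewrite scale0r add0r => gu.
    by rewrite -(subrr (g u)); apply: cvgB => //; exact: cvg_cst.
  exact/differentiable_continuous/derivable1_diffP/(derivable1P _ _ _).1.
have dvj j : h^-1 * v h 0 j @[h --> 0^'] --> ('D_w g u) 0 j.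
  rewrite derive_mx// mxE.
  have -> : (fun h => h^-1 * v h 0 j) = fun h => h^-1 *:
      (((fun x => g x 0 j) \o shift u) (h *: w) - g u 0 j).
    by apply/funext => h; rewrite !mxE.
  exact: ((derivable_mxP g u w).1 dg 0 j).
have cvgF : h^-1 *: (((F \o g) \o shift u) (h *: w) - (F \o g) u) @[h --> 0^'] -->
    \sum_j 'D_(Defs.coord R j) F (g u) * ('D_w g u) 0 j.
  have -> : (fun h : R => h^-1 *: (((F \o g) \o shift u) (h *: w) - (F \o g) u)) =
      fun h => \sum_j 'D_(Defs.coord R j) F (g u + p j (v h)) * (h^-1 * v h 0 j).
    apply/funext => h /=; rewrite -[g (h *: w + u)](subrKC (g u)) pE.
    rewrite [_ *: _]mulr_sumr; apply: eq_bigr => j _.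
    by rewrite mulrA mulrC.
  apply: cvg_big => [|j _]; first exact: add_continuous.
  apply: cvgM => //.
  apply: (cvg_comp (fun h => g u + p j (v h)) ('D_(Defs.coord R j) F));
    last exact: cF.
  have pv0 : (p j \o v) @ 0^' --> (0 : V).
    apply/cvgr0Pnorm_lt => e e0.
    move/cvgr0Pnorm_lt : v0 => /(_ e e0).
    by apply: filterS => h; exact/le_lt_trans/pv.
  by have := cvgD (cvg_cst (g u)) pv0; rewrite addr0; exact.
split; first by apply/cvg_ex; eexists; exact: cvgF.
exact: cvg_lim cvgF.
Qed.

End chain_rule.

(** * Sums, products and compositions of smooth functions *)

Section closure_properties.
Variables (R : realType) (U : normedModType R) (I : eqType) (e : I -> U).
Implicit Types (f g h : U -> R).

Lemma rsmooth_cst (W : normedModType R) (c : W) : rsmooth e (cst c : U -> W).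
Proof.
apply: (@rsmooth_coind _ _ _ _ _ (fun F : U -> W => exists c, F = cst c));
  last by exists c.
move=> _ [a ->]; split => [|x i|i]; first exact: cst_continuous.
  exact: derivable_cst.
by exists 0; apply/funext => x; rewrite derive_cst.
Qed.

Lemma rpderives_entry n (g : U -> 'rV[R]_n) (j : 'I_n) s : rsmooth e g ->
  rpderives e s (fun u => g u 0 j) = fun u => rpderives e s g u 0 j.
Proof.
move=> sg; elim: s => //= i s ->; apply/funext => u.
rewrite [in RHS]derive_mx ?mxE//.
exact: (sg s).2.
Qed.

Lemma rsmooth_entry n (g : U -> 'rV[R]_n) (j : 'I_n) :
  rsmooth e g -> rsmooth e (fun u => g u 0 j).
Proof.
move=> sg s; rewrite rpderives_entry//; split.
  move=> u; apply: (cvg_comp (rpderives e s g) (fun v : 'rV[R]_n => v 0 j)).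
    exact: (sg s).1.
  exact: coord_continuous.
move=> u i; exact: ((derivable_mxP _ _ _).1 ((sg s).2 u i)).
Qed.

Section comp.
Variables (n : nat) (g : U -> 'rV[R]_n).

(* The closure of the smooth functions and of the compositions [F \o g] under
   sums and products is stable under differentiation, so that smoothness of
   sums, products and compositions is obtained in one coinduction.            *)
Inductive smooth_closure : (U -> R) -> Prop :=
| closure_smooth f of rsmooth e f : smooth_closure f
| closure_comp F of rsmooth (@Defs.coord R n) F : smooth_closure (F \o g)
| closureD f h of smooth_closure f & smooth_closure h : smooth_closure (f + h)
| closureM f h of smooth_closure f & smooth_closure h : smooth_closure (f * h).

Hypothesis sg : rsmooth e g.

Lemma derive_comp_coord (F : 'rV[R]_n -> R) i : rsmooth (@Defs.coord R n) F ->
  'D_(e i) (F \o g) =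
  \sum_j ('D_(Defs.coord R j) F \o g) * (fun u => 'D_(e i) g u 0 j).
Proof.
move=> sF; apply/funext => u; rewrite fct_sumE.
apply: derive_val; apply: is_derive_comp_partials.
- by move=> y j; exact: rsmooth_derivable.
- by move=> j; exact: (sF [:: j]).1.
- exact: rsmooth_derivable.
Qed.

Lemma rsmooth_closure f : smooth_closure f -> rsmooth e f.
Proof.
apply: rsmooth_coind => {}f; elim=> {f}.
- move=> f sf; split => [|x i|i]; first exact: rsmooth_continuous sf.
    exact: rsmooth_derivable.
  exact/closure_smooth/rsmooth_derive.
- move=> F sF; split => [|u i|i].
  + move=> u; apply: continuous_comp; first exact: (sg [::]).1.
    exact: (sF [::]).1.
  + apply: ex_derive; apply: is_derive_comp_partials.
    * by move=> y j; exact: rsmooth_derivable.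
    * by move=> j; exact: (sF [:: j]).1.
    * exact: rsmooth_derivable.
  + rewrite derive_comp_coord//; apply: (big_ind smooth_closure).
    * exact/closure_smooth/rsmooth_cst.
    * exact: closureD.
    * move=> j _; apply: closureM; first exact/closure_comp/rsmooth_derive.
      exact/closure_smooth/rsmooth_entry/rsmooth_derive.
- move=> f h _ [cf df Df] _ [ch dh Dh]; split => [u|x i|i].
  + by apply: continuousD; [exact: cf|exact: ch].
  + exact: derivableD.
  + have -> : 'D_(e i) (f + h) = 'D_(e i) f + 'D_(e i) h.
      by apply/funext => u; rewrite deriveD.
    exact: closureD.
- move=> f h gf [cf df Df] gh [ch dh Dh]; split => [u|x i|i].
  + by apply: continuousM; [exact: cf|exact: ch].
  + exact: derivableM.
  + have -> : 'D_(e i) (f * h) = f * 'D_(e i) h + h * 'D_(e i) f.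
      by apply/funext => u; rewrite deriveM.
    by apply: closureD; apply: closureM.
Qed.

Lemma rsmooth_comp (F : 'rV[R]_n -> R) :
  rsmooth (@Defs.coord R n) F -> rsmooth e (F \o g).
Proof. by move=> sF; exact/rsmooth_closure/closure_comp. Qed.

End comp.

(** Sums and products involve no inner map; the constant map to R^0 serves as a trivial one for
    [smooth_closure]. *)
Let g0 : U -> 'rV[R]_0 := cst 0.
Let sg0 : rsmooth e g0. Proof. exact: rsmooth_cst. Qed.

Lemma rsmoothD f h : rsmooth e f -> rsmooth e h -> rsmooth e (f + h).
Proof.
move=> sf sh; apply: (rsmooth_closure sg0).
by apply: closureD; exact: closure_smooth.
Qed.

Lemma rsmoothM f h : rsmooth e f -> rsmooth e h -> rsmooth e (f * h).
Proof.
move=> sf sh; apply: (rsmooth_closure sg0).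
by apply: closureM; exact: closure_smooth.
Qed.

Lemma rsmooth_sum (J : Type) (r : seq J) (P : pred J) (F : J -> U -> R) :
  (forall j, P j -> rsmooth e (F j)) -> rsmooth e (\sum_(j <- r | P j) F j).
Proof. by apply: big_ind; [exact: rsmooth_cst|exact: rsmoothD]. Qed.

Lemma rpderivesD s f h : rsmooth e f -> rsmooth e h ->
  rpderives e s (f + h) = rpderives e s f + rpderives e s h.
Proof.
move=> sf sh; elim: s => //= i s ->; apply/funext => u.
by rewrite deriveD//; [exact: (sf s).2|exact: (sh s).2].
Qed.

Lemma rpderives_sum (J : Type) s (r : seq J) (F : J -> U -> R) :
  (forall j, rsmooth e (F j)) ->
  rpderives e s (\sum_(j <- r) F j) = \sum_(j <- r) rpderives e s (F j).
Proof.
move=> sF; elim: r => [|j r IH]; last first.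
  by rewrite !big_cons rpderivesD ?IH//; exact: rsmooth_sum.
rewrite !big_nil; elim: s => //= i s ->; apply/funext => u.
by rewrite derive_cst.
Qed.

Lemma near_rpderives s f h (u : U) : (\forall x \near u, f x = h x) ->
  \forall x \near u, rpderives e s f x = rpderives e s h x.
Proof.
move=> fh; elim: s => //= i s /near_join; apply: filterS => x.
exact: near_eq_derive.
Qed.

End closure_properties.

(** * Functions of two variables with one variable fixed *)

Section slices.
Variables (R : realType) (n : nat) (W : normedModType R).
Local Notation V := 'rV[R]_n.
Implicit Types (Phi : V * V -> W) (s : seq 'I_n).

Lemma is_derive_slice_r Phi x y j : rsmooth (@coord2 R n) Phi ->
  is_derive y (Defs.coord R j) (fun y => Phi (x, y))
    ('D_(coord2 R (inr j)) Phi (x, y)).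
Proof.
move=> sPhi; apply: (@is_derive_affine _ _ _ _ Phi (pair x)) => [h|].
  by congr pair; rewrite /= scaler0 add0r.
exact: (sPhi [::]).2.
Qed.

Lemma is_derive_slice_l Phi x y j : rsmooth (@coord2 R n) Phi ->
  is_derive x (Defs.coord R j) (fun x => Phi (x, y))
    ('D_(coord2 R (inl j)) Phi (x, y)).
Proof.
move=> sPhi; apply: (@is_derive_affine _ _ _ _ Phi (pair^~ y)) => [h|].
  by congr pair; rewrite /= scaler0 add0r.
exact: (sPhi [::]).2.
Qed.

Lemma rpderives_slice_r s Phi x : rsmooth (@coord2 R n) Phi ->
  rpderives (@Defs.coord R n) s (fun y => Phi (x, y)) =
  fun y => rpderives (@coord2 R n) (map inr s) Phi (x, y).
Proof.
move=> sPhi; elim: s => //= j s ->; apply/funext => y.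
exact/derive_val/is_derive_slice_r/rsmooth_rpderives.
Qed.

Lemma rsmooth_slice_r Phi x : rsmooth (@coord2 R n) Phi ->
  rsmooth (@Defs.coord R n) (fun y => Phi (x, y)).
Proof.
move=> sPhi s; rewrite rpderives_slice_r//; split => [y|y i].
  apply: (continuous_comp (f := pair x)); last exact: (sPhi _).1.
  move=> A /= [[B C] /= [Bx Cy] BC]; apply: filterS Cy => z Cz.
  by apply: BC; split => //; exact: nbhs_singleton.
exact/ex_derive/is_derive_slice_r/rsmooth_rpderives.
Qed.

End slices.

(** * Jets *)

Section multi_indices.
Variable n : nat.
Implicit Types (s : seq 'I_n) (mu : multi_index n).

Definition mi_count s : multi_index n := [ffun i => count_mem i s].

Lemma count_mi_seq mu i : count_mem i (mi_seq mu) = mu i.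
Proof.
rewrite count_flatten -map_comp sumnE big_map big_enum /= (bigD1 i)//=.
rewrite count_nseq /= eqxx mul1n big1 ?addn0// => j ji.
by rewrite count_nseq /= (negbTE ji).
Qed.

Lemma perm_mi_seq s : perm_eq (mi_seq (mi_count s)) s.
Proof. by apply/allP => i _; rewrite /= count_mi_seq ffunE. Qed.

Lemma size_mi_seq mu : size (mi_seq mu) = mi_abs mu.
Proof.
rewrite size_flatten /shape -map_comp sumnE big_map big_enum.
by apply: eq_bigr => i _; rewrite /= size_nseq.
Qed.

Lemma mi_abs_count s : mi_abs (mi_count s) = size s.
Proof. by rewrite -size_mi_seq (perm_size (perm_mi_seq s)). Qed.

Lemma mi_seq0 : mi_seq [ffun=> 0%N] = [::] :> seq 'I_n.
Proof.
by apply: size0nil; rewrite size_mi_seq /mi_abs big1// => i _; rewrite ffunE.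
Qed.

End multi_indices.

Section jets.
Variables (R : realType) (n : nat).
Local Notation V := 'rV[R]_n.
Local Notation rp := (rpderives (@Defs.coord R n)).
Local Notation rsm := (rsmooth (@Defs.coord R n)).
Implicit Types (f h : V -> R) (y : V) (M N : R).

(** Words replace multi-indices because removing the last letter, the innermost derivative, gives
    the induction of [jet_leS]. *)
Definition jet_le (l : nat) f y M :=
  forall s, (size s <= l)%N -> `|rp s f y| <= M.

Lemma jet_le_ge0 l f y M : jet_le l f y M -> 0 <= M.
Proof. by move=> /(_ [::] isT); exact: le_trans. Qed.

Lemma jet_le0 l f y M : jet_le l f y M -> `|f y| <= M.
Proof. by move=> /(_ [::] isT). Qed.

Lemma jet_le_weak l f y M N : M <= N -> jet_le l f y M -> jet_le l f y N.
Proof. by move=> MN fM s sl; exact: le_trans (fM s sl) MN. Qed.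

Lemma jet_leS l f y M : jet_le l.+1 f y M <->
  `|f y| <= M /\ forall i, jet_le l ('D_(Defs.coord R i) f) y M.
Proof.
split => [fM|[f0 fS] s].
  split=> [|i s sl]; first exact: jet_le0 fM.
  by have := fM (rcons s i); rewrite size_rcons -cats1 rpderives_cat; exact.
case/lastP: s => // s i; rewrite size_rcons ltnS -cats1 rpderives_cat.
exact: fS.
Qed.

Lemma jet_leSw l f y M : jet_le l.+1 f y M -> jet_le l f y M.
Proof. by move=> fM s sl; apply: fM; exact: leqW. Qed.

Lemma jet_leD l f h y M N : rsm f -> rsm h ->
  jet_le l f y M -> jet_le l h y N -> jet_le l (f + h) y (M + N).
Proof.
move=> sf sh fM hN s sl.
have -> : rp s (f + h) y = rp s f y + rp s h y by rewrite (rpderivesD s sf sh).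
by rewrite (le_trans (ler_normD _ _))// lerD ?fM ?hN.
Qed.

Lemma jet_le_sum l (F : 'I_n -> V -> R) y M : (forall j, rsm (F j)) ->
  (forall j, jet_le l (F j) y M) -> jet_le l (\sum_j F j) y (n%:R * M).
Proof.
move=> sF FM s sl; rewrite rpderives_sum// fct_sumE.
rewrite (le_trans (ler_norm_sum _ _ _))//.
apply: (@le_trans _ _ (\sum_(j < n) M)).
  by apply: ler_sum => j _; exact: FM.
by rewrite sumr_const card_ord mulr_natl.
Qed.

(** Each application of the Leibniz rule doubles the number of terms, whence the factor 2^l. *)
Lemma jet_leM l f h y M N : rsm f -> rsm h ->
  jet_le l f y M -> jet_le l h y N -> jet_le l (f * h) y (2 ^+ l * (M * N)).
Proof.
elim: l f h => [|l IH] f h sf sh fM hN.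
  move=> s; rewrite leqn0 => /nilP ->; rewrite expr0 mul1r /= normrM.
  by rewrite ler_pM ?(jet_le0 fM) ?(jet_le0 hN).
have M0 := jet_le_ge0 fM; have N0 := jet_le_ge0 hN.
apply/jet_leS; split.
  rewrite normrM (@le_trans _ _ (M * N))//.
    by rewrite ler_pM ?(jet_le0 fM) ?(jet_le0 hN).
  by rewrite ler_peMl ?mulr_ge0// exprn_ege1// ler1n.
move=> i.
have -> : 'D_(Defs.coord R i) (f * h) =
    f * 'D_(Defs.coord R i) h + 'D_(Defs.coord R i) f * h.
  apply/funext => u.
  have := deriveM (rsmooth_derivable u i sf) (rsmooth_derivable u i sh).
  by rewrite [X in _ = _ + X]mulrC.
have -> : 2 ^+ l.+1 * (M * N) = 2 ^+ l * (M * N) + 2 ^+ l * (M * N).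
  by rewrite exprS -mulrA mulr_natl mulr2n.
have sDf := rsmooth_derive i sf; have sDh := rsmooth_derive i sh.
have /jet_leS[_ /(_ i) DfM] := fM; have /jet_leS[_ /(_ i) DhN] := hN.
apply: (jet_leD (rsmoothM sf sDh) (rsmoothM sDf sh)).
  exact: (IH _ _ sf sDh (jet_leSw fM) DhN).
exact: (IH _ _ sDf sh DfM (jet_leSw hN)).
Qed.

(** D_i (f o g) is a sum of n products (D_j f o g) * D_i g_j. Passing from order l to l+1 costs n
    for the sum, 2^l for the products and D (l+1) for the l-jet of D_i g_j; the [+ 1] keeps each
    factor at least 1, so that the bound also covers the derivative of order 0. *)
Lemma jet_le_comp (g : V -> V) (D : nat -> R) l f y M : rsm g -> rsm f ->
  (forall k, 0 <= D k) ->
  (forall k j, jet_le k (fun y => g y 0 j) y (D k)) ->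
  jet_le l f (g y) M ->
  jet_le l (f \o g) y ((\prod_(k < l) (n%:R * (2 ^+ k * D k.+1) + 1)) * M).
Proof.
move=> sg + D0 gD; elim: l f => [|l IH] f sf fM.
  move=> s; rewrite leqn0 => /nilP ->; rewrite big_ord0 mul1r.
  exact: jet_le0 fM.
have M0 := jet_le_ge0 fM; rewrite big_ord_recr /=.
set P := \prod_(k < l) _ in IH *; set d := n%:R * _.
have d0 : 0 <= d by rewrite !mulr_ge0.
have P1 : 1 <= P.
  rewrite /P; apply: (big_ind (fun x => 1 <= x)) => // [a b a1 b1|k _].
    by rewrite mulr_ege1.
  by rewrite lerDr !mulr_ge0.
have P0 : 0 <= P by rewrite (le_trans _ P1).
apply/jet_leS; split.
  rewrite (le_trans (jet_le0 fM))// ler_peMl// mulr_ege1// lerDr//.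
move=> i; rewrite (derive_comp_coord sg)//.
apply: (@jet_le_weak _ _ _ (n%:R * (2 ^+ l * ((P * M) * D l.+1)))).
  have -> : n%:R * (2 ^+ l * (P * M * D l.+1)) = d * (P * M) by rewrite /d; ring.
  have -> : P * (d + 1) * M = (d + 1) * (P * M) by ring.
  by rewrite ler_wpM2r ?mulr_ge0// lerDl.
have sj j : rsm ('D_(Defs.coord R j) f \o g).
  exact: (rsmooth_comp sg (rsmooth_derive j sf)).
have sgj j : rsm (fun u => 'D_(Defs.coord R i) g u 0 j).
  exact: (rsmooth_entry j (rsmooth_derive i sg)).
have /jet_leS[_ DfM] := fM.
apply: (jet_le_sum (fun j => rsmoothM (sj j) (sgj j))) => j.
apply: (jet_leM (sj j) (sgj j)).
  exact: (IH _ (rsmooth_derive j sf) (DfM j)).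
have /jet_leS[_ /(_ i)] := gD l.+1 j.
by have := @rpderives_entry R V _ (@Defs.coord R n) n g j [:: i] sg => /= ->.
Qed.

Lemma jet_bounded_compact (K : set V) l f : compact K -> rsm f ->
  exists2 M : R, 0 <= M & forall y, K y -> jet_le l f y M.
Proof.
move=> cK; have B0 f' : rsm f' -> exists2 M : R, 0 <= M &
    forall y, K y -> `|f' y| <= M.
  move=> sf; have : compact (f' @` K).
    apply: continuous_compact cK.
    exact/continuous_subspaceT/(rsmooth_continuous sf).
  move=> /compact_bounded/pinfty_ex_gt0[M M0 KM]; exists M; first exact: ltW.
  by move=> y Ky; apply: KM; exists y.
elim: l f => [|l IH] f sf.
  have [M M0 KM] := B0 f sf; exists M => // y Ky s; rewrite leqn0 => /nilP ->.
  exact: KM.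
have [M M0 KM] := B0 f sf.
have /choice[N NP] i : exists N : R, 0 <= N /\
    forall y, K y -> jet_le l ('D_(Defs.coord R i) f) y N.
  by have [N N0 KN] := IH _ (rsmooth_derive i sf); exists N.
have N0 : 0 <= \sum_i N i by apply: sumr_ge0 => i _; exact: (NP i).1.
exists (M + \sum_i N i); first by rewrite addr_ge0.
move=> y Ky; apply/jet_leS; split; first by rewrite (le_trans (KM y Ky))// lerDl.
move=> i; apply: jet_le_weak ((NP i).2 y Ky).
rewrite (bigD1 i)//= addrCA lerDl addr_ge0// sumr_ge0// => j _.
exact: (NP j).1.
Qed.

End jets.

(** * Uniform convergence of jets on a compact set *)

Section uniform.
Variables (R : realType) (n : nat) (K : set 'rV[R]_n).
Local Notation V := 'rV[R]_n.
Hypothesis cK : compact K.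
Implicit Types Phi : V * V -> R.

Lemma near_uniform Phi (e : R) : continuous Phi -> 0 < e ->
  \forall x \near (0 : V), forall y, K y -> `|Phi (x, y) - Phi (0, y)| <= e.
Proof.
move=> cPhi e0.
apply: ((compact_near_coveringP K).1 cK V (nbhs (0 : V))
  (fun x y => `|Phi (x, y) - Phi (0, y)| <= e)) => y Ky.
have e20 : 0 < e / 2 by rewrite divr_gt0.
have /cvgrPdist_lt /(_ _ e20) [[A B] /= [A0 By] AB] := cPhi (0, y).
exists (B, A) => //= -[y' x] /= [By' Ax].
rewrite [e]splitr (le_trans (ler_distD (Phi (0, y)) _ _))// lerD//.
  by rewrite distrC ltW//; exact: (AB (x, y')).
by rewrite ltW//; apply: (AB (0, y')); split => //; exact: nbhs_singleton.
Qed.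

Let PhiSl Phi j : rsmooth (@coord2 R n) Phi ->
  rsmooth (@coord2 R n) ('D_(coord2 R j) Phi).
Proof. exact: rsmooth_derive. Qed.

(** A y-derivative of a slice is a slice of a derivative of Phi, so the induction replaces Phi by
    its y-derivatives; the finitely many neighbourhoods of 0, one for each i, are intersected. *)
Lemma jet_near_uniform l Phi (e : R) : rsmooth (@coord2 R n) Phi -> 0 < e ->
  \forall x \near (0 : V), forall y, K y ->
    jet_le l (fun y => Phi (x, y) - Phi (0, y)) y e.
Proof.
move=> + e0; elim: l Phi => [|l IH] Phi sPhi.
  apply: filterS (near_uniform (rsmooth_continuous sPhi) e0) => x xe y Ky s.
  by rewrite leqn0 => /nilP ->; exact: xe.
near=> x => y Ky; apply/jet_leS; split => [|i].
  by move: y Ky; near: x; exact: near_uniform (rsmooth_continuous sPhi) e0.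
have -> : 'D_(Defs.coord R i) (fun y => Phi (x, y) - Phi (0, y)) =
    fun y => 'D_(coord2 R (inr i)) Phi (x, y) - 'D_(coord2 R (inr i)) Phi (0, y).
  apply/funext => z; apply: derive_val.
  by apply: is_deriveB; exact: is_derive_slice_r.
move: i y Ky; near: x; apply: filter_forall => i.
exact: (IH _ (PhiSl (inr i) sPhi)).
Unshelve. all: by end_near. Qed.

(** By the mean value theorem in x the quotient is d Phi / d x_i at (t e_i, y) with |t| <= |h|, and
    [near_uniform] applies to this derivative. *)
Lemma near_quotient Phi i (e : R) : rsmooth (@coord2 R n) Phi -> 0 < e ->
  \forall h \near (0 : R)^', forall y, K y ->
    `|h^-1 * (Phi (h *: Defs.coord R i, y) - Phi (0, y)) -
      'D_(coord2 R (inl i)) Phi (0, y)| <= e.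
Proof.
move=> sPhi e0.
have /nbhs_norm0P[d /= d0 dP] :=
  near_uniform (rsmooth_continuous (PhiSl (inl i) sPhi)) e0.
near=> h => y Ky.
have h0 : h != 0 by near: h; exact: nbhs_dnbhs_neq.
have hd : `|h| < d by near: h; exact: dnbhs0_lt.
have [t th] := MVT_line (0, y) h (fun x => rsmooth_derivable x (inl i) sPhi).
have -> : (0, y) + h *: coord2 R (inl i) = (h *: Defs.coord R i, y).
  by congr pair; rewrite /= ?add0r ?scaler0 ?addr0.
have -> : (0, y) + t *: coord2 R (inl i) = (t *: Defs.coord R i, y).
  by congr pair; rewrite /= ?add0r ?scaler0 ?addr0.
move=> ->; rewrite mulKf//; apply: dP => //=.
rewrite normrZ (le_lt_trans _ hd)//.
apply: (@le_trans _ _ (`|t| * 1)); last by rewrite mulr1.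
rewrite ler_wpM2l// /Num.Def.normr/= mx_normrE bigmax_le// => -[a b] _.
by rewrite mxE; case: (_ && _); rewrite ?normr1 ?normr0.
Unshelve. all: by end_near. Qed.

Lemma jet_near_quotient l Phi i (e : R) : rsmooth (@coord2 R n) Phi -> 0 < e ->
  \forall h \near (0 : R)^', forall y, K y ->
    jet_le l (fun y => h^-1 * (Phi (h *: Defs.coord R i, y) - Phi (0, y)) -
      'D_(coord2 R (inl i)) Phi (0, y)) y e.
Proof.
move=> + e0; elim: l Phi => [|l IH] Phi sPhi.
  apply: filterS (near_quotient i sPhi e0) => x xe y Ky s.
  by rewrite leqn0 => /nilP ->; exact: xe.
near=> h => y Ky; apply/jet_leS; split => [|j].
  by move: y Ky; near: h; exact: near_quotient sPhi e0.
have -> : 'D_(Defs.coord R j) (fun y => h^-1 * (Phi (h *: Defs.coord R i, y) -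
      Phi (0, y)) - 'D_(coord2 R (inl i)) Phi (0, y)) =
    fun y => h^-1 * ('D_(coord2 R (inr j)) Phi (h *: Defs.coord R i, y) -
      'D_(coord2 R (inr j)) Phi (0, y)) -
      'D_(coord2 R (inl i)) ('D_(coord2 R (inr j)) Phi) (0, y).
  (* As d/dx_i and d/dy_j commute, differentiating in y_j gives the same expression with d Phi / d
     y_j in place of Phi. *)
  apply/funext => z; have := rpderivesC (inl i) (inr j) sPhi.
  move=> /(congr1 (fun F => F (0, z))) /= ->.
  have D1 := is_derive_slice_r (h *: Defs.coord R i) z j sPhi.
  have D2 := is_derive_slice_r 0 z j sPhi.
  have D3 := is_derive_slice_r 0 z j (PhiSl (inl i) sPhi).
  have D := is_deriveB (is_deriveZ h^-1 (is_deriveB D1 D2)) D3.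
  exact: (@derive_val _ _ _ _ _ _ _ D).
move: j y Ky; near: h; apply: filter_forall => j.
exact: (IH _ (PhiSl (inr j) sPhi)).
Unshelve. all: by end_near. Qed.

End uniform.

(** * Complex-valued functions *)

Section complex_functions.
Variables (R : realType).
Local Notation C := (R[i]^o).
Local Notation Re := (@complex.Re R).
Local Notation Im := (@complex.Im R).

Lemma Re_le_normc (z : R[i]) : `|Re z| <= Normc.normc z.
Proof. by case: z => a b /=; rewrite -sqrtr_sqr ler_wsqrtr// lerDl sqr_ge0. Qed.

Lemma Im_le_normc (z : R[i]) : `|Im z| <= Normc.normc z.
Proof. by case: z => a b /=; rewrite -sqrtr_sqr ler_wsqrtr// lerDr sqr_ge0. Qed.

Lemma normc_le_ReIm (z : R[i]) : Normc.normc z <= `|Re z| + `|Im z|.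
Proof.
case: z => a b /=.
have -> : Num.sqrt (a ^+ 2 + b ^+ 2) =
    Normc.normc (Complex a 0 + Complex 0 b).
  by rewrite /= addr0 add0r.
rewrite (le_trans (le_normcD _ _))//= expr0n/= addr0 add0r !sqrtr_sqr//.
Qed.

Lemma cvg_Complex (T : Type) (F : set_system T) (a b : T -> R) (A B : R) :
  Filter F -> a @ F --> A -> b @ F --> B ->
  (fun t => Complex (a t) (b t) : C) @ F --> (Complex A B : C).
Proof.
move=> FF aA bB; apply/cvgrPdist_lt => e.
(* A positive element of [R[i]] has imaginary part 0, so e is a positive real. *)
rewrite ltcE => /andP[/eqP e0 Re0].
have -> : e = (Re e)%:C%C by case: e e0 {Re0} => x y /= ->.
have e20 : 0 < Re e / 2 by rewrite divr_gt0.
move/cvgrPdist_lt : aA => /(_ _ e20); move/cvgrPdist_lt : bB => /(_ _ e20).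
apply: filterS2 => t Bt At; rewrite -normc_normr ltcR.
by rewrite (le_lt_trans (normc_le_ReIm _))//= [Re e]splitr ltrD.
Qed.

Lemma Re_continuous : continuous (Re : C -> R).
Proof.
move=> z A /nbhs_ballP[e /= e0 eA].
apply/(@nbhs_ballP _ C); exists e%:C%C => [|t zt]; first by rewrite /= ltcR.
apply: eA; move: zt; rewrite -!ball_normE /= -normc_normr ltcR; apply: le_lt_trans.
by rewrite -raddfB Re_le_normc.
Qed.

Lemma Im_continuous : continuous (Im : C -> R).
Proof.
move=> z A /nbhs_ballP[e /= e0 eA].
apply/(@nbhs_ballP _ C); exists e%:C%C => [|t zt]; first by rewrite /= ltcR.
apply: eA; move: zt; rewrite -!ball_normE /= -normc_normr ltcR; apply: le_lt_trans.
by rewrite -raddfB Im_le_normc.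
Qed.

Variable n : nat.
Local Notation V := 'rV[R]_n.
Local Notation rp := (rpderives (@Defs.coord R n)).
Local Notation rsm := (rsmooth (@Defs.coord R n)).
Implicit Types (f : V -> C) (u v : V -> R) (s : seq 'I_n).

Let complexf u v : V -> C := fun x => Complex (u x) (v x).

Let diffquotE u v (x : V) i h : diffquot (complexf u v) x i h =
  Complex (h^-1 *: ((u \o shift x) (h *: Defs.coord R i) - u x))
          (h^-1 *: ((v \o shift x) (h *: Defs.coord R i) - v x)).
Proof.
rewrite /diffquot /complexf /= [x + _]addrC.
by rewrite /GRing.scale/= /GRing.mul/= !mul0r subr0 addr0.
Qed.

Let complexf_ReIm f : complexf (Re \o f) (Im \o f) = f.
Proof. by apply/funext => x; rewrite /complexf /=; case: (f x). Qed.

Lemma cvg_diffquot_Complex u v (x : V) i :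
  derivable u x (Defs.coord R i) -> derivable v x (Defs.coord R i) ->
  diffquot (complexf u v) x i h @[h --> 0^'] -->
    (Complex ('D_(Defs.coord R i) u x) ('D_(Defs.coord R i) v x) : C).
Proof.
move=> du dv.
have -> : diffquot (complexf u v) x i = (fun h => Complex
    (h^-1 *: ((u \o shift x) (h *: Defs.coord R i) - u x))
    (h^-1 *: ((v \o shift x) (h *: Defs.coord R i) - v x)) : C).
  by apply/funext => h; exact: diffquotE.
exact: (cvg_Complex _ du dv).
Qed.

Lemma pderives_Complex s f : rsm (Re \o f) -> rsm (Im \o f) ->
  pderives s f = fun x => Complex (rp s (Re \o f) x) (rp s (Im \o f) x).
Proof.
move=> sr si; elim: s => [|i s IH] /=; first by rewrite -[LHS]complexf_ReIm.
apply/funext => x; rewrite IH; apply: (pderiveP (@C_hausdorff R)).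
by apply: cvg_diffquot_Complex; [exact: (sr s).2|exact: (si s).2].
Qed.

Lemma smooth_Complex f : rsm (Re \o f) -> rsm (Im \o f) -> smooth f.
Proof.
move=> sr si s; rewrite pderives_Complex//; split => [x|x i].
  exact: (cvg_Complex _ ((sr s).1 x) ((si s).1 x)).
eexists; apply: cvg_diffquot_Complex; [exact: (sr s).2|exact: (si s).2].
Qed.

Let is_derive_Re f (x : V) i : pderivable f x i ->
  is_derive x (Defs.coord R i) (Re \o f) (Re (pderive i f x)).
Proof.
move=> /(pderive_cvg (@C_hausdorff R)); set l := pderive i f x => fl.
have {}fl : (fun h => h^-1 *:
    (((Re \o f) \o shift x) (h *: Defs.coord R i) - (Re \o f) x))
    @ 0^' --> Re l.
  rewrite [X in X @ _](_ : _ = Re \o diffquot f x i).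
    exact: (cvg_comp _ _ fl (@Re_continuous l)).
  by apply/funext => h /=; rewrite -{3}(complexf_ReIm f) diffquotE.
split; first by apply/cvg_ex; exists (Re l).
exact: cvg_lim fl.
Qed.

Let is_derive_Im f (x : V) i : pderivable f x i ->
  is_derive x (Defs.coord R i) (Im \o f) (Im (pderive i f x)).
Proof.
move=> /(pderive_cvg (@C_hausdorff R)); set l := pderive i f x => fl.
have {}fl : (fun h => h^-1 *:
    (((Im \o f) \o shift x) (h *: Defs.coord R i) - (Im \o f) x))
    @ 0^' --> Im l.
  rewrite [X in X @ _](_ : _ = Im \o diffquot f x i).
    exact: (cvg_comp _ _ fl (@Im_continuous l)).
  by apply/funext => h /=; rewrite -{3}(complexf_ReIm f) diffquotE.
split; first by apply/cvg_ex; exists (Im l).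
exact: cvg_lim fl.
Qed.

Lemma smooth_rpderives_Re s f : smooth f -> rp s (Re \o f) = Re \o pderives s f.
Proof.
move=> sf; elim: s => //= i s ->; apply/funext => x.
by apply: derive_val; apply: is_derive_Re; exact: (sf s).2.
Qed.

Lemma smooth_rpderives_Im s f : smooth f -> rp s (Im \o f) = Im \o pderives s f.
Proof.
move=> sf; elim: s => //= i s ->; apply/funext => x.
by apply: derive_val; apply: is_derive_Im; exact: (sf s).2.
Qed.

Lemma smooth_Re f : smooth f -> rsm (Re \o f).
Proof.
move=> sf s; rewrite smooth_rpderives_Re//; split => [x|x i].
  by apply: continuous_comp; [exact: (sf s).1|exact: Re_continuous].
by apply: ex_derive; apply: is_derive_Re; exact: (sf s).2.
Qed.

Lemma smooth_Im f : smooth f -> rsm (Im \o f).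
Proof.
move=> sf s; rewrite smooth_rpderives_Im//; split => [x|x i].
  by apply: continuous_comp; [exact: (sf s).1|exact: Im_continuous].
by apply: ex_derive; apply: is_derive_Im; exact: (sf s).2.
Qed.

Lemma pderives_pd s f : smooth f -> pderives s f = pd (mi_count s) f.
Proof.
move=> sf; have := perm_mi_seq s; rewrite perm_sym => E.
have [sr si] := (smooth_Re sf, smooth_Im sf).
rewrite /pd !pderives_Complex//.
by rewrite (rpderives_perm sr E) (rpderives_perm si E).
Qed.

Definition cjet_le l f y M := jet_le l (Re \o f) y M /\ jet_le l (Im \o f) y M.

Lemma cjet_le_pderives l f y M : smooth f ->
  (forall s, (size s <= l)%N -> Normc.normc (pderives s f y) <= M) ->
  cjet_le l f y M.
Proof.
move=> sf fM; split => s sl.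
  by rewrite smooth_rpderives_Re// (le_trans (Re_le_normc _))// fM.
by rewrite smooth_rpderives_Im// (le_trans (Im_le_normc _))// fM.
Qed.

Lemma pderives_cjet_le l f y M s : smooth f -> cjet_le l f y M ->
  (size s <= l)%N -> Normc.normc (pderives s f y) <= M *+ 2.
Proof.
move=> sf [fr fi] sl; rewrite (le_trans (normc_le_ReIm _))// mulr2n.
have := fr s sl; have := fi s sl.
rewrite smooth_rpderives_Re// smooth_rpderives_Im//= => H1 H2.
exact: lerD.
Qed.

End complex_functions.

(** * Compactly supported actions *)

Lemma jbr_ge1 (R : realType) n (x : 'rV[R]_n) : 1 <= jbr x.
Proof. by rewrite lerDl sumr_ge0// => i _; exact: sqr_ge0. Qed.

Lemma powR_ge1 (R : realType) (a p : R) : 1 <= a -> 0 <= p -> 1 <= a `^ p.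
Proof. by move=> a1 p0; rewrite -[leLHS](powRr0 a) ler_powR. Qed.

Lemma Re_quotient (R : realType) (c : R) (u v w : R[i]^o) :
  complex.Re (c%:C%C *: (u - v) - w) =
  c * (complex.Re u - complex.Re v) - complex.Re w.
Proof. by case: u v w => [? ?] [? ?] [? ?] /=; rewrite mul0r subr0. Qed.

Lemma Im_quotient (R : realType) (c : R) (u v w : R[i]^o) :
  complex.Im (c%:C%C *: (u - v) - w) =
  c * (complex.Im u - complex.Im v) - complex.Im w.
Proof. by case: u v w => [? ?] [? ?] [? ?] /=; rewrite mul0r addr0. Qed.

Section action.
Variables (R : realType) (n : nat) (K : set 'rV[R]_n) (b : nat -> R).
Variable tau : 'rV[R]_n -> 'rV[R]_n -> 'rV[R]_n.
Hypothesis cK : compact K.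
Hypothesis b_ge0 : forall l, 0 <= b l.
Hypothesis tau_act : smooth_compact_action K b tau.
Local Notation V := 'rV[R]_n.
Local Notation rp := (rpderives (@Defs.coord R n)).
Local Notation rsm := (rsmooth (@Defs.coord R n)).
Local Notation rsm2 := (rsmooth (@coord2 R n)).
Local Notation C := (R[i]^o).
Local Notation Re := (@complex.Re R).
Local Notation Im := (@complex.Im R).
Local Notation T := (fun z : V * V => tau z.1 z.2).

Let sT : rsm2 T. Proof. by case: tau_act. Qed.
Let tau0 y : tau 0 y = y. Proof. by case: tau_act => _ []. Qed.
Let tauD x x' y : tau x (tau x' y) = tau (x + x') y.
Proof. by case: tau_act => _ []. Qed.
Let tau_off x y : ~ K y -> tau x y = y.
Proof. by case: tau_act => _ _ + _ => /(_ x y). Qed.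
Let clK : closed K. Proof. exact: compact_closed (@norm_hausdorff _ _) cK. Qed.

Let sTx x : rsm (tau x).
Proof. exact: (rsmooth_slice_r x sT). Qed.

(** A point tau_x(y) outside K would be fixed by tau_{-x}, which maps it back to y; then y itself
    would lie outside K. *)
Lemma action_stable x y : K y -> K (tau x y).
Proof.
move=> Ky; apply: contrapT => nK; have := tau_off (- x) nK.
by rewrite tauD addNr tau0 => E; apply: nK; rewrite -E.
Qed.

(* By the chain rule, only y-derivatives of [tau x] of orders 1, ..., l enter a
   y-derivative of order l of [f \o tau x].                                   *)
Definition jet_order l : R := \sum_(k < l) b k.+1.

(** [jet_le_comp] at a point of K, with the jets of tau_x bounded by condition (3) for mu = 0. The
    exponents of the successive factors add up to [jet_order l / 2]. *)
Lemma action_jet_growth l : exists2 c : R, 0 <= c &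
  forall x y (f : V -> R) M, K y -> rsm f -> jet_le l f (tau x y) M ->
    jet_le l (f \o tau x) y (c * jbr x `^ (jet_order l / 2) * M).
Proof.
case: tau_act => _ _ _ bnd.
have /choice[c cP] k : exists c : R, 0 < c /\ forall x y j, K y ->
    jet_le k (fun y => tau x y 0 j) y (c * jbr x `^ (b k / 2)).
  have [c c0 cP] := bnd [ffun=> 0%N] k; exists c; split => // x y j Ky s sk.
  have := cP x y (mi_count s) j Ky; rewrite mi_abs_count => /(_ sk).
  rewrite /rpd mi_seq0 /= (rpderives_perm _ (perm_mi_seq s))//.
  exact: (rsmooth_entry j (sTx x)).
pose d k := n%:R * (2 ^+ k * c k.+1) + 1.
have d1 k : 1 <= d k by rewrite lerDr !mulr_ge0// ltW//; exact: (cP _).1.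
have d0 k : 0 <= d k by exact: le_trans (d1 k).
exists (\prod_(k < l) d k); first by apply: prodr_ge0.
move=> x y f M Ky sf fM.
pose D k := c k * jbr x `^ (b k / 2).
have D0 k : 0 <= D k by rewrite mulr_ge0// ?powR_ge0// ltW//; exact: (cP k).1.
have M0 := jet_le_ge0 fM.
apply: jet_le_weak
  (jet_le_comp (sTx x) sf D0 (fun k j => (cP k).2 x y j Ky) fM).
rewrite ler_wpM2r// /jet_order; elim: l {fM} => [|l IH].
  by rewrite !big_ord0 mul0r powRr0 mulr1.
rewrite !big_ord_recr /= mulrDl powRD; last first.
  by rewrite (gt_eqF (jbr_gt0 x)) implybT.
rewrite mulrACA; apply: ler_pM => //.
- by apply: prodr_ge0 => k _; rewrite addr_ge0// mulr_ge0// mulr_ge0.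
- by rewrite addr_ge0// mulr_ge0// mulr_ge0.
(* Since b is non-negative, p >= 1, and the summand 1 of the factor can be multiplied by p as
   well. *)
- rewrite /d /D; set p := jbr x `^ _.
  have p1 : 1 <= p by rewrite powR_ge1 ?jbr_ge1// divr_ge0.
  have -> : n%:R * (2 ^+ l * (c l.+1 * p)) = n%:R * (2 ^+ l * c l.+1) * p by ring.
  by rewrite mulrDl mul1r lerD2l.
Qed.

Definition vfield (i : 'I_n) (f : V -> R) : V -> R :=
  fun y => 'D_(coord2 R (inl i)) (f \o T) (0, y).

Let coef i j : V -> R := fun y => 'D_(coord2 R (inl i)) T (0, y) 0 j.

Let scoef i j : rsm (coef i j).
Proof.
exact: (rsmooth_slice_r 0 (rsmooth_entry j (rsmooth_derive (inl i) sT))).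
Qed.

Let vfieldE i f : rsm f ->
  vfield i f = \sum_j ('D_(Defs.coord R j) f) * coef i j.
Proof.
move=> sf; apply/funext => y.
apply: etrans (congr1 (@^~ (0, y)) (derive_comp_coord sT (inl i) sf)) _.
by rewrite !fct_sumE; apply: eq_bigr => j _; rewrite /GRing.mul/= tau0.
Qed.

Lemma rsmooth_vfield i f : rsm f -> rsm (vfield i f).
Proof.
move=> sf.
exact: (rsmooth_slice_r 0 (rsmooth_derive (inl i) (rsmooth_comp sT sf))).
Qed.

Lemma vfield_off i f y : rsm f -> ~ K y -> vfield i f y = 0.
Proof.
move=> sf nKy; have D := is_derive_slice_l 0 y i (rsmooth_comp sT sf).
apply: etrans (esym (@derive_val _ _ _ _ _ _ _ D)) _.
have -> : (fun x => (f \o T) (x, y)) = cst (f y).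
  by apply/funext => x; rewrite /= tau_off.
exact: derive_cst.
Qed.

(** X_i is a first-order operator, so it costs one derivative; its coefficients are smooth, with
    jets bounded on the compact K, so the constant does not depend on f. *)
Lemma vfield_jet i l : exists2 c : R, 0 <= c & forall f y M, K y -> rsm f ->
  jet_le l.+1 f y M -> jet_le l (vfield i f) y (c * M).
Proof.
have /choice[N NP] j : exists N : R, 0 <= N /\
    forall y, K y -> jet_le l (coef i j) y N.
  by have [N N0 NP] := jet_bounded_compact l cK (scoef i j); exists N.
have N0 : 0 <= \sum_j N j by apply: sumr_ge0 => j _; exact: (NP j).1.
exists (n%:R * (2 ^+ l * \sum_j N j)); first by rewrite !mulr_ge0.
move=> f y M Ky sf /jet_leS[_ fM]; rewrite vfieldE//.
have -> : n%:R * (2 ^+ l * \sum_j N j) * M = n%:R * (2 ^+ l * (M * \sum_j N j)).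
  by ring.
apply: (jet_le_sum (fun j => rsmoothM (rsmooth_derive j sf) (scoef i j))) => j.
apply: (jet_leM (rsmooth_derive j sf) (scoef i j)) => //.
apply: jet_le_weak ((NP j).2 y Ky).
by rewrite (bigD1 j)//= lerDl sumr_ge0// => k _; exact: (NP k).1.
Qed.

Lemma vfield_near i l f (e : R) : rsm f -> 0 < e ->
  \forall h \near (0 : R)^', forall y, K y ->
    jet_le l (fun y => h^-1 * (f (tau (h *: Defs.coord R i) y) - f y) -
      vfield i f y) y e.
Proof.
move=> sf e0; have := jet_near_quotient cK l i (rsmooth_comp sT sf) e0.
apply: filterS => h hP y Ky; have := hP y Ky.
by congr (jet_le _ _ _ _); apply/funext => z; rewrite /= tau0.
Qed.

Lemma action_near l f (e : R) : rsm f -> 0 < e ->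
  \forall x \near (0 : V), forall y, K y ->
    jet_le l (fun y => f (tau x y) - f y) y e.
Proof.
move=> sf e0; have := jet_near_uniform cK l (rsmooth_comp sT sf) e0.
apply: filterS => h hP y Ky; have := hP y Ky.
by congr (jet_le _ _ _ _); apply/funext => z; rewrite /= tau0.
Qed.

Implicit Types f : V -> C.

Lemma smooth_pullback x f : smooth f -> smooth (f \o tau x).
Proof.
move=> sf; apply: smooth_Complex.
  exact: (rsmooth_comp (sTx x) (smooth_Re sf)).
exact: (rsmooth_comp (sTx x) (smooth_Im sf)).
Qed.

Lemma cjet_growth l : exists2 c : R, 0 <= c &
  forall x y f M, K y -> smooth f -> cjet_le l f (tau x y) M ->
    cjet_le l (f \o tau x) y (c * jbr x `^ (jet_order l / 2) * M).
Proof.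
have [c c0 cP] := action_jet_growth l; exists c => // x y f M Ky sf [fr fi].
split; first exact: (cP _ _ _ _ Ky (smooth_Re sf) fr).
exact: (cP _ _ _ _ Ky (smooth_Im sf) fi).
Qed.

Definition cvfield i f : V -> C :=
  fun y => Complex (vfield i (Re \o f) y) (vfield i (Im \o f) y).

Lemma smooth_cvfield i f : smooth f -> smooth (cvfield i f).
Proof.
move=> sf; apply: smooth_Complex.
  exact: (rsmooth_vfield i (smooth_Re sf)).
exact: (rsmooth_vfield i (smooth_Im sf)).
Qed.

Lemma cvfield_off i f y : smooth f -> ~ K y -> cvfield i f y = 0.
Proof.
move=> sf nK; rewrite /cvfield (vfield_off _ (smooth_Re sf))//.
by rewrite (vfield_off _ (smooth_Im sf)).
Qed.

Lemma cvfield_jet i l : exists2 c : R, 0 <= c & forall f y M, K y -> smooth f ->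
  cjet_le l.+1 f y M -> cjet_le l (cvfield i f) y (c * M).
Proof.
have [c c0 cP] := vfield_jet i l; exists c => // f y M Ky sf [fr fi].
split; first exact: (cP _ _ _ Ky (smooth_Re sf) fr).
exact: (cP _ _ _ Ky (smooth_Im sf) fi).
Qed.

Lemma cvfield_near i l f (e : R) : smooth f -> 0 < e ->
  \forall h \near (0 : R)^', forall y, K y ->
    cjet_le l (h^-1%:C%C *: (f \o tau (h *: Defs.coord R i) - f) -
      cvfield i f) y e.
Proof.
move=> sf e0; near=> h => y Ky; split.
  have -> : Re \o (h^-1%:C%C *: (f \o tau (h *: Defs.coord R i) - f) -
        cvfield i f) =
      fun y => h^-1 * ((Re \o f) (tau (h *: Defs.coord R i) y) - (Re \o f) y) -
        vfield i (Re \o f) y.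
    by apply/funext => z; exact: (Re_quotient _ (f _) (f z) (cvfield i f z)).
  by move: y Ky; near: h; exact: (vfield_near i l (smooth_Re sf) e0).
have -> : Im \o (h^-1%:C%C *: (f \o tau (h *: Defs.coord R i) - f) -
      cvfield i f) =
    fun y => h^-1 * ((Im \o f) (tau (h *: Defs.coord R i) y) - (Im \o f) y) -
      vfield i (Im \o f) y.
  by apply/funext => z; exact: (Im_quotient _ (f _) (f z) (cvfield i f z)).
by move: y Ky; near: h; exact: (vfield_near i l (smooth_Im sf) e0).
Unshelve. all: by end_near. Qed.

Lemma caction_near l f (e : R) : smooth f -> 0 < e ->
  \forall x \near (0 : V), forall y, K y -> cjet_le l (f \o tau x - f) y e.
Proof.
move=> sf e0; near=> x => y Ky; split.
  have -> : Re \o (f \o tau x - f) = fun y => (Re \o f) (tau x y) - (Re \o f) y.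
    by apply/funext => z; rewrite /= raddfB.
  by move: y Ky; near: x; exact: (action_near l (smooth_Re sf) e0).
have -> : Im \o (f \o tau x - f) = fun y => (Im \o f) (tau x y) - (Im \o f) y.
  by apply/funext => z; rewrite /= raddfB.
by move: y Ky; near: x; exact: (action_near l (smooth_Im sf) e0).
Unshelve. all: by end_near. Qed.

End action.

(** * Locally convex spaces *)

Section lcs_bounded.
Variable R : realType.
Implicit Types V : lcs R.

(** The seminorm criterion for continuity of a linear map. A sum over a list replaces the maximum
    over a finite set, so that composition amounts to concatenation of lists. *)
Definition sn_bounded V V' (T : V -> V') := forall k : lcs_idx V',
  exists (D : seq (lcs_idx V)) (c : R), 0 <= c /\
    forall v, lcs_sn k (T v) <= c * \sum_(q <- D) lcs_sn q v.

Lemma sum_sn_ge0 V (D : seq (lcs_idx V)) (v : V) : 0 <= \sum_(q <- D) lcs_sn q v.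
Proof. by apply: sumr_ge0 => q _; exact: lcs_sn_ge0. Qed.

Lemma sn_bounded_id V : sn_bounded (@id V).
Proof. by move=> k; exists [:: k], 1; split => // v; rewrite mul1r big_seq1. Qed.

Lemma sn_bounded_sum V V' (T : V -> V') (D : seq (lcs_idx V')) : sn_bounded T ->
  exists (D' : seq (lcs_idx V)) (c : R), 0 <= c /\
    forall v, \sum_(q <- D) lcs_sn q (T v) <= c * \sum_(q <- D') lcs_sn q v.
Proof.
move=> bT; elim: D => [|q D [D' [c [c0 cP]]]].
  by exists [::], 0; split => // v; rewrite !big_nil mulr0.
have [D2 [c2 [c20 c2P]]] := bT q.
exists (D2 ++ D'), (c2 + c); split; first exact: addr_ge0.
move=> v; rewrite big_cons big_cat /= mulrDl lerD//.
  by rewrite (le_trans (c2P v))// ler_wpM2l// lerDl sum_sn_ge0.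
by rewrite (le_trans (cP v))// ler_wpM2l// lerDr sum_sn_ge0.
Qed.

Lemma sn_bounded_comp V V' V'' (S : V' -> V'') (T : V -> V') :
  sn_bounded S -> sn_bounded T -> sn_bounded (S \o T).
Proof.
move=> bS bT k; have [D [c [c0 cP]]] := bS k.
have [D' [c' [c'0 c'P]]] := sn_bounded_sum D bT.
exists D', (c * c'); split; first exact: mulr_ge0.
by move=> v; rewrite (le_trans (cP _))// -mulrA ler_wpM2l.
Qed.

Lemma near_sum_sn V (D : seq (lcs_idx V)) (v : V) (e : R) : 0 < e ->
  \forall w \near v, \sum_(q <- D) lcs_sn q (w - v) < e.
Proof.
elim: D e => [|k D IH] e e0; first by near=> w; rewrite big_nil.
have e20 : 0 < e / 2 by rewrite divr_gt0.
have kv : \forall w \near v, lcs_sn k (w - v) < e / 2.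
  exists [set k], (e / 2); split => //.
  by move=> w /(_ k erefl).
near=> w; rewrite big_cons [e]splitr ltrD//; first by near: w.
by near: w; exact: IH.
Unshelve. all: by end_near. Qed.

Lemma lcs_cvg V (X : Type) (F : set_system X) (g : X -> V) (l : V) : Filter F ->
  (forall k (e : R), 0 < e -> \forall t \near F, lcs_sn k (g t - l) < e) ->
  g @ F --> l.
Proof.
move=> FF H A [D [e [Df e0 DA]]].
(* The copy [{classic lcs_idx V}] supplies decidable equality on the index type, for enumerating D
   and induction on the list. *)
have /finite_seqP[s sE] : finite_set (D : set {classic lcs_idx V}) by [].
suff : \forall t \near F, forall q, q \in s -> lcs_sn q (g t - l) < e.
  apply: filterS => t tP; apply: DA => q Dq; apply: tP.
  by have : [set` s] q by rewrite -sE.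
elim: s {sE} => [|k s IH]; first by near=> t.
near=> t => q; rewrite inE => /orP[/eqP ->|]; first by near: t; exact: H.
by move: q; near: t.
Unshelve. all: by end_near. Qed.

Lemma sn_bounded_continuous V V' (T : V -> V') :
  (forall v w, T w - T v = T (w - v)) -> sn_bounded T -> continuous T.
Proof.
move=> TB bT v; apply: (@lcs_cvg V' V (nbhs v) T (T v) (nbhs_filter v)) => k e e0.
have [D [c [c0 cP]]] := bT k.
have ec : 0 < e / (c + 1) by rewrite divr_gt0// ltr_wpDl.
near=> w; rewrite TB; apply: le_lt_trans (cP _) _.
have : \sum_(q <- D) lcs_sn q (w - v) < e / (c + 1).
  by near: w; exact: near_sum_sn.
rewrite ltr_pdivlMr ?ltr_wpDl//; apply: le_lt_trans.
by rewrite mulrC ler_wpM2l ?sum_sn_ge0// lerDl.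
Unshelve. all: by end_near. Qed.

End lcs_bounded.

Section fspace_elements.
Variables (R : realType) (n : nat) (W : tvsType R[i]) (E : fspace n W).

Lemma fs_mem_pred (F : 'rV[R]_n -> W) : fs_mem E F -> F \in fs_pred E.
Proof. by move=> ?; apply/asboolP. Qed.

Definition fs_mk (F : 'rV[R]_n -> W) (FE : fs_mem E F) : E := FsElt (fs_mem_pred FE).

Lemma fs_fun_inj (f g : E) : fs_fun f = fs_fun g -> f = g.
Proof. exact: val_inj. Qed.

Lemma fs_funD (f g : E) : fs_fun (f + g) = fs_fun f + fs_fun g.
Proof. by []. Qed.

Lemma fs_funB (f g : E) : fs_fun (f - g) = fs_fun f - fs_fun g.
Proof. by []. Qed.

Lemma fs_funZ (c : R[i]) (f : E) : fs_fun (c *: f) = c *: fs_fun f.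
Proof. by []. Qed.

End fspace_elements.

(* A function space whose elements may be modified arbitrarily on the compact
   set [K] within the smooth functions, and whose topology restricts on [K] to
   uniform convergence of all derivatives. *)
Record local_on (R : realType) (n : nat) (K : set 'rV[R]_n)
    (E : @fspace R n R[i]^o) : Prop := LocalOn {
  local_smooth : forall f, fs_mem E f -> smooth f;
  local_mem : forall f g, fs_mem E f -> smooth g ->
    (forall y, ~ K y -> g y = f y) -> fs_mem E g;
  local_le : forall k : fs_idx E, exists l (c : R), 0 <= c /\ forall f g M,
    fs_mem E f -> smooth g -> (forall y, ~ K y -> g y = f y) -> 0 <= M ->
    (forall y, K y -> cjet_le l g y M) -> fs_sn k g <= fs_sn k f + c * M;
  local_ge : forall s, exists (k : fs_idx E) (c : R), 0 <= c /\ forall f y,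
    fs_mem E f -> K y -> Normc.normc (pderives s f y) <= c * fs_sn k f }.

(** * Orbits of the pullback action on a function space local on K *)

Section local_action.
Variables (R : realType) (n : nat) (K : set 'rV[R]_n) (b : nat -> R).
Variable tau : 'rV[R]_n -> 'rV[R]_n -> 'rV[R]_n.
Hypothesis cK : compact K.
Hypothesis b_ge0 : forall l, 0 <= b l.
Hypothesis tau_act : smooth_compact_action K b tau.
Variable E : @fspace R n R[i]^o.
Hypothesis locE : local_on K E.
Local Notation V := 'rV[R]_n.
Local Notation C := (R[i]^o).

Let tau0 y : tau 0 y = y. Proof. by case: tau_act => _ []. Qed.
Let tauD x x' y : tau x (tau x' y) = tau (x + x') y.
Proof. by case: tau_act => _ []. Qed.
Let tau_off x y : ~ K y -> tau x y = y.
Proof. by case: tau_act => _ _ + _ => /(_ x y). Qed.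

Let smoothE (f : E) : smooth (fs_fun f).
Proof. exact/(local_smooth locE)/fs_val_mem. Qed.

Let pullback_mem x (f : E) : fs_mem E (fs_fun f \o tau x).
Proof.
apply: (local_mem locE (fs_val_mem f)).
  exact: (smooth_pullback tau_act x (smoothE f)).
by move=> y nKy; rewrite /= tau_off.
Qed.

Definition pullback x (f : E) : E := fs_mk (pullback_mem x f).

(** X_i f vanishes off K, so it is a smooth modification on K of the zero function. *)
Let generator_mem i (f : E) : fs_mem E (cvfield tau i (fs_fun f)).
Proof.
apply: (local_mem locE (fs_mem0 E)).
  exact: (smooth_cvfield tau_act i (smoothE f)).
by move=> y nKy; rewrite (cvfield_off tau_act).
Qed.

Definition generator i (f : E) : E := fs_mk (generator_mem i f).

Lemma pullback_linear x (c : R[i]) (f g : E) :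
  pullback x (c *: f + g) = c *: pullback x f + pullback x g.
Proof. by apply: fs_fun_inj; rewrite fs_funD fs_funZ. Qed.

Lemma pullbackB x (f g : E) : pullback x (f - g) = pullback x f - pullback x g.
Proof. by apply: fs_fun_inj; rewrite fs_funB. Qed.

Lemma pullbackZ x (c : R[i]) (f : E) : pullback x (c *: f) = c *: pullback x f.
Proof. by apply: fs_fun_inj; rewrite fs_funZ. Qed.

Lemma pullback0 f : pullback 0 f = f.
Proof. by apply/fs_fun_inj/funext => y; rewrite /fs_fun /= tau0. Qed.

Lemma pullbackD x x' f : pullback x (pullback x' f) = pullback (x + x') f.
Proof.
apply/fs_fun_inj/funext => y; rewrite /fs_fun /=.
by rewrite tauD addrC.
Qed.

(** Words of length at most l form the finite type [l.-bseq 'I_n]; summing the constants and the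
    seminorms of [local_ge] over it bounds all these derivatives at once. *)
Lemma local_cjet l : exists (D : seq (lcs_idx E)) (c : R), 0 <= c /\
  forall (f : E) y, K y -> cjet_le l (fs_fun f) y (c * \sum_(q <- D) lcs_sn q f).
Proof.
have /choice[k kP] s := local_ge locE s; have /choice[c cP] := kP.
exists [seq k (bseqval t) | t <- enum {: l.-bseq 'I_n}].
exists (\sum_(t : l.-bseq 'I_n) c t); split.
  by apply: sumr_ge0 => t _; exact: (cP _).1.
move=> f y Ky; apply: cjet_le_pderives => [|s sl]; first exact: smoothE.
have [c0 fc] := cP s; rewrite (le_trans (fc _ _ (fs_val_mem f) Ky))//.
rewrite big_map big_enum /= -[s]/(bseqval (Bseq sl)).
rewrite ler_pM//; first exact: (lcs_sn_ge0 _ (f : E)).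
  rewrite (bigD1 (Bseq sl))//= lerDl sumr_ge0// => t _; exact: (cP _).1.
rewrite (bigD1 (Bseq sl))//= lerDl sumr_ge0// => t _.
exact: (lcs_sn_ge0 _ (f : E)).
Qed.

Let sn_sub_ge0 (q : lcs_idx E) (f : E) : 0 <= lcs_sn q f := lcs_sn_ge0 q f.

Lemma pullback_growth (k : lcs_idx E) : exists m : R,
  exists (D : seq (lcs_idx E)) (c : R), 0 <= c /\ forall x f,
    lcs_sn k (pullback x f) <=
      jbr x `^ (m / 2) * (c * \sum_(q <- D) lcs_sn q f).
Proof.
have [l [c [c0 cP]]] := local_le locE k.
have [D [d [d0 dP]]] := local_cjet l.
have [a a0 aP] := cjet_growth b_ge0 tau_act l.
(* The index [k] and the summand 1 pay for the points off K, where f o tau_x = f; the product c * (a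
   * d) pays for K. *)
exists (jet_order b l), (k :: D), (1 + c * (a * d)).
split; first by rewrite addr_ge0// !mulr_ge0.
move=> x f; set p := jbr x `^ _; set S := \sum_(q <- D) lcs_sn q f.
have S0 : 0 <= S by exact: sum_sn_ge0.
have p1 : 1 <= p.
  by rewrite powR_ge1 ?jbr_ge1// divr_ge0// sumr_ge0.
have p0 : 0 <= p by exact: le_trans p1.
have := cP (fs_fun f) (fs_fun f \o tau x) (a * p * (d * S)) (fs_val_mem f)
  (smooth_pullback tau_act x (smoothE f)).
move=> /(_ _ _ _)/le_trans; apply.
- by move=> y nKy; rewrite /= tau_off.
- by rewrite !mulr_ge0.
- move=> y Ky; apply: aP => //; apply: dP; exact: (action_stable tau_act).
rewrite big_cons -/S -[fs_sn k _]/(lcs_sn k f); set s := lcs_sn k f.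
have s0 : 0 <= s by exact: lcs_sn_ge0.
(* The claimed bound equals the available one plus a remainder, non-negative because p >= 1. *)
have -> : p * ((1 + c * (a * d)) * (s + S)) =
  s + c * (a * p * (d * S)) + ((p - 1) * s + p * S + p * (c * (a * d) * s)) by ring.
by rewrite lerDl !addr_ge0// ?mulr_ge0// subr_ge0.
Qed.

Lemma generator_bounded i : sn_bounded (generator i).
Proof.
move=> k; have [l [c [c0 cP]]] := local_le locE k.
have [D [d [d0 dP]]] := local_cjet l.+1.
have [a a0 aP] := cvfield_jet cK tau_act i l.
exists D, (c * (a * d)); split; first by rewrite !mulr_ge0.
move=> f; set S := \sum_(q <- D) lcs_sn q f.
have S0 : 0 <= S by exact: sum_sn_ge0.
have := cP 0 (cvfield tau i (fs_fun f)) (a * (d * S)) (fs_mem0 E)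
  (smooth_cvfield tau_act i (smoothE f)).
move=> /(_ _ _ _)/le_trans; apply.
- by move=> y nKy; rewrite (cvfield_off tau_act).
- by rewrite !mulr_ge0.
- by move=> y Ky; apply: aP => //; exact: dP.
rewrite -[fs_sn k 0]/(lcs_sn k (0 : E)) lcs_sn0 add0r.
by rewrite !mulrA.
Qed.

Let near_small (X : Type) (F : set_system X) (g : X -> E) (k : lcs_idx E)
    (e : R) :
  Filter F -> (forall x y, ~ K y -> fs_fun (g x) y = 0) ->
  (forall l (d : R), 0 < d ->
    \forall x \near F, forall y, K y -> cjet_le l (fs_fun (g x)) y d) ->
  0 < e -> \forall x \near F, lcs_sn k (g x) < e.
Proof.
move=> FF goff gnear e0; have [l [c [c0 cP]]] := local_le locE k.
have d0 : 0 < e / (c + 1) by rewrite divr_gt0// ltr_wpDl.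
apply: filterS (gnear l _ d0) => x xP.
have := cP 0 (fs_fun (g x)) (e / (c + 1)) (fs_mem0 E) (smoothE _).
move=> /(_ (goff x) (ltW d0) xP)/le_lt_trans; apply.
rewrite -[fs_sn k 0]/(lcs_sn k (0 : E)) lcs_sn0 add0r.
by rewrite mulrA ltr_pdivrMr ?ltr_wpDl// mulrC ltr_pM2l// ltrDl.
Qed.

Lemma pullback_near0 k (f : E) (e : R) : 0 < e ->
  \forall x \near (0 : V), lcs_sn k (pullback x f - f) < e.
Proof.
move=> e0; apply: (@near_small V (nbhs (0 : V)) (fun x => pullback x f - f) k e
  (nbhs_filter _) _ _ e0) => [x y nKy|l d d0].
  by rewrite fs_funB /fs_fun /= /GRing.add/= tau_off// subrr.
exact: (caction_near cK tau_act l (smoothE f) d0).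
Qed.

Lemma pullback_quotient k i (f : E) (e : R) : 0 < e ->
  \forall h \near (0 : R)^',
    lcs_sn k (h^-1%:C%C *: (pullback (h *: Defs.coord R i) f - f) -
      generator i f) < e.
Proof.
move=> e0; apply: (@near_small R (0 : R)^' (fun h =>
  h^-1%:C%C *: (pullback (h *: Defs.coord R i) f - f) - generator i f) k e
  _ _ _ e0) => [h y nKy|l d d0].
  have -> : fs_fun (h^-1%:C%C *: (pullback (h *: Defs.coord R i) f - f) -
        generator i f) y =
      h^-1%:C%C *: (fs_fun f (tau (h *: Defs.coord R i) y) - fs_fun f y) -
      cvfield tau i (fs_fun f) y by [].
  by rewrite tau_off// subrr scaler0 (cvfield_off tau_act)// subr0.
exact: (cvfield_near cK tau_act i l (smoothE f) d0).
Qed.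

Definition orbit (f : E) : V -> lcs_space E := pullback^~ f.

Lemma cvg_pullback x (X : Type) (F : set_system X) (g : X -> E) (l : E) :
  Filter F -> g @ F --> l -> pullback x (g t) @[t --> F] --> pullback x l.
Proof.
move=> FF gl; apply: (cvg_comp _ _ gl).
apply: sn_bounded_continuous => [v w|k]; first by rewrite pullbackB.
have [m [D [c [c0 cP]]]] := pullback_growth k.
exists D, (jbr x `^ (m / 2) * c); split; first by rewrite mulr_ge0// powR_ge0.
by move=> v; rewrite -mulrA.
Qed.

(** By the group law the quotient at x is [pullback x] applied to the quotient at 0, whose limit
    [generator i f] is carried along by continuity of [pullback x]. *)
Lemma diffquot_orbit f x i :
  diffquot (orbit f) x i h @[h --> 0^'] --> orbit (generator i f) x.
Proof.
have -> : diffquot (orbit f) x i = fun h : R =>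
    pullback x (h^-1%:C%C *: (pullback (h *: Defs.coord R i) f - f)).
  by apply/funext => h; rewrite pullbackZ pullbackB pullbackD.
apply: cvg_pullback; apply: lcs_cvg => k e; exact: pullback_quotient.
Qed.

Lemma orbit_continuous f : continuous (orbit f).
Proof.
move=> x; have zx : pullback (z - x) f @[z --> x] --> f.
  apply: (@lcs_cvg _ _ _ _ _ _ (nbhs_filter x)) => k e e0.
  by have := pullback_near0 k f e0; rewrite (near_shift x) /= sub0r.
have := @cvg_pullback x _ _ _ _ (nbhs_filter x) zx.
rewrite (_ : (fun z => pullback x (pullback (z - x) f)) = orbit f); first exact.
by apply/funext => z; rewrite pullbackD subrKC.
Qed.

Lemma pderives_orbit s f : pderives s (orbit f) = orbit (foldr generator f s).
Proof.
elim: s => //= i s ->; apply/funext => x.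
exact: (pderiveP (@lcs_hausdorff R E) (@diffquot_orbit _ x i)).
Qed.

Lemma smooth_orbit f : smooth (orbit f).
Proof.
move=> s; rewrite pderives_orbit; split; first exact: orbit_continuous.
by move=> x i; eexists; exact: diffquot_orbit.
Qed.

Lemma generators_bounded s : sn_bounded (fun f => foldr generator f s).
Proof.
elim: s => [|i s IH]; first exact: sn_bounded_id.
exact: (sn_bounded_comp (generator_bounded i) IH).
Qed.

Theorem local_pullback_polybounded : pullback_polybounded tau E.
Proof.
exists pullback; split => //.
have /choice[m mP] := pullback_growth.
exists m; split; [exact: pullback_linear|exact: pullback0|exact: pullbackD|].
(* This single estimate yields both that each orbit lies in the symbol space and that v |-> alpha(v)
   is continuous. The growth bound is applied to the iterated generators of f, whose seminorms are
   bounded by those of f without reference to x. *)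
have orbit_le (k : lcs_idx E * multi_index n) :
    exists (D : seq (lcs_idx E)) (c : R), 0 <= c /\ forall x f,
      jbr x `^ (- m k.1 / 2) * lcs_sn k.1 (pd k.2 (orbit f) x) <=
      c * \sum_(q <- D) lcs_sn q f.
  case: k => k mu /=; have [D [c [c0 cP]]] := mP k.
  have [D' [c' [c'0 c'P]]] := sn_bounded_sum D (generators_bounded (mi_seq mu)).
  exists D', (c * c'); split; first exact: mulr_ge0.
  move=> x f; rewrite /pd pderives_orbit.
  have p0 : 0 < jbr x `^ (m k / 2) by exact: jbr_powR_gt0.
  rewrite mulNr powRN ler_pdivrMl// (le_trans (cP _ _))// ler_pM2l//.
  by rewrite -mulrA ler_wpM2l.
have orbit_mem f : fs_mem (vsymbol_fspace n m) (orbit f).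
  split; first exact: smooth_orbit.
  move=> k; have [D [c [c0 cP]]] := orbit_le k.
  by exists (c * \sum_(q <- D) lcs_sn q f) => _ [x _ <-]; exact: cP.
exists (fun f => fs_mk (orbit_mem f)) => //.
apply: sn_bounded_continuous => [v w|k].
  by apply/fs_fun_inj/funext => x; rewrite /fs_fun /= /orbit pullbackB.
have [D [c [c0 cP]]] := orbit_le k; exists D, c; split => // f.
apply: ge_sup.
  by exists (jbr (0 : V) `^ (- m k.1 / 2) * lcs_sn k.1 (pd k.2 (orbit f) 0)), 0.
by move=> _ [x _ <-]; exact: cP.
Qed.

End local_action.

(** * The three function spaces *)

Section local_spaces.
Variables (R : realType) (n : nat) (K : set 'rV[R]_n).
Hypothesis cK : compact K.
Local Notation V := 'rV[R]_n.
Local Notation C := (R[i]^o).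
Implicit Types (f g : V -> C).

Let clK : closed K. Proof. exact: compact_closed (@norm_hausdorff _ _) cK. Qed.

(** The complement of K is open, so f and g agree near y and the derivatives, being local, agree at
    y. *)
Lemma pderives_off s f g y : smooth f -> smooth g ->
  (forall y, ~ K y -> g y = f y) -> ~ K y -> pderives s g y = pderives s f y.
Proof.
move=> sf sg fg nKy.
have nK : \forall x \near y, ~ K x.
  by apply: open_nbhs_nbhs; split => //; exact: closed_openC.
rewrite (pderives_Complex _ (smooth_Re sf) (smooth_Im sf)).
rewrite (pderives_Complex _ (smooth_Re sg) (smooth_Im sg)).
have Er : \forall x \near y, (@complex.Re R \o g) x = (@complex.Re R \o f) x.
  by near=> x; rewrite /= fg//; near: x.
have Ei : \forall x \near y, (@complex.Im R \o g) x = (@complex.Im R \o f) x.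
  by near=> x; rewrite /= fg//; near: x.
rewrite (nbhs_singleton (near_rpderives (@Defs.coord R n) s Er)).
by rewrite (nbhs_singleton (near_rpderives (@Defs.coord R n) s Ei)).
Unshelve. all: by end_near. Qed.

Lemma cjet_bounded_compact l f : smooth f ->
  exists2 M : R, 0 <= M & forall y, K y -> cjet_le l f y M.
Proof.
move=> sf; have [M M0 MP] := jet_bounded_compact l cK (smooth_Re sf).
have [N N0 NP] := jet_bounded_compact l cK (smooth_Im sf).
exists (M + N) => [|y Ky]; first exact: addr_ge0.
split; first by apply: jet_le_weak (MP y Ky); rewrite lerDl.
by apply: jet_le_weak (NP y Ky); rewrite lerDr.
Qed.

Lemma fs_sn_ge0 (E : @fspace R n C) (k : fs_idx E) f :
  fs_mem E f -> 0 <= fs_sn k f.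
Proof. by move=> fE; exact: (@lcs_sn_ge0 R E k (fs_mk fE)). Qed.

(** The assumption 0 <= M covers the empty set, where [sup] takes the default value 0; it occurs for
    [Cinf_sn] with J empty. *)
Lemma sup_le_ge0 (A : set R) (M : R) : 0 <= M -> ubound A M -> sup A <= M.
Proof.
move=> M0 AM; have [->|/set0P A0] := eqVneq A set0; first by rewrite sup0.
exact: ge_sup.
Qed.

(** Off K the weighted values of f and g coincide, whatever the weight does at infinity. On K, upper
    bounds for the weights control seminorms by jets, and a weight bounded below for each nu
    controls jets by seminorms. *)
Lemma local_weighted (X : Type) (mu : X -> multi_index n) (w : X -> V -> R)
    hW w_gt0 p_ge0 pD pZ p_sep :
  (forall k, exists2 B : R, 0 <= B & forall y, K y -> w k y <= B) ->
  (forall nu, exists2 k, mu k = nu & exists2 B : R, 0 <= B &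
    forall y, K y -> 1 <= B * w k y) ->
  local_on K (@weighted_fspace R n C X mu w (fun=> @Normc.normc R)
    hW w_gt0 p_ge0 pD pZ p_sep).
Proof.
move=> w_ub w_lb; set E := weighted_fspace _ _ _ _ _ _.
have wK k g y M B : smooth g -> w k y <= B -> cjet_le (mi_abs (mu k)) g y M ->
    w k y * Normc.normc (pd (mu k) g y) <= B * (M *+ 2).
  move=> sg wB gM; rewrite ler_pM ?normc_ge0// ?(ltW (w_gt0 _ _))//.
  by apply: pderives_cjet_le gM _ => //; rewrite size_mi_seq.
split.
- by move=> f [].
- move=> f g [sf bf] sg fg; split => // k; have [F FP] := bf k.
  have [B B0 wB] := w_ub k.
  have [M M0 MP] := cjet_bounded_compact (mi_abs (mu k)) sg.
  exists (Num.max F (B * (M *+ 2))) => _ [x _ <-]; rewrite le_max.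
  have [Kx|nKx] := pselect (K x).
    by rewrite (wK _ _ _ _ _ sg (wB x Kx) (MP x Kx)) orbT.
  by rewrite /pd (pderives_off _ sf sg)// FP//; exists x.
- move=> k; have [B B0 wB] := w_ub k.
  (* The factor 2 comes from estimating real and imaginary parts separately. *)
  exists (mi_abs (mu k)), (B *+ 2); split; first by rewrite mulrn_wge0.
  move=> f g M fE sg fg M0 gM; have [sf bf] := fE.
  have f0 : 0 <= fs_sn k f := fs_sn_ge0 k fE.
  have BM0 : 0 <= B *+ 2 * M by rewrite mulr_ge0// mulrn_wge0.
  apply: sup_le_ge0; first exact: addr_ge0.
  move=> _ [x _ <-]; have [Kx|nKx] := pselect (K x).
    rewrite (le_trans (wK _ _ _ _ _ sg (wB x Kx) (gM x Kx)))//.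
    by rewrite mulrnAr -mulrnAl lerDr.
  rewrite /pd (pderives_off _ sf sg)//.
  apply: (@le_trans _ _ (fs_sn k f)); last by rewrite lerDl.
  exact: (ub_le_sup (bf k) (ex_intro2 _ _ x I erefl)).
- move=> s; have [k kE [B B0 wB]] := w_lb (mi_count s).
  exists k, B; split => // f y fE Ky; have [sf bf] := fE.
  rewrite (pderives_pd _ sf) -kE.
  apply: (@le_trans _ _ (B * w k y * Normc.normc (pd (mu k) f y))).
    by rewrite ler_peMl ?normc_ge0// wB.
  rewrite -mulrA ler_wpM2l//; exact: (ub_le_sup (bf k) (ex_intro2 _ _ y I erefl)).
Qed.

Lemma jbr_bounded : exists2 J : R, 1 <= J & forall y, K y -> jbr y <= J.
Proof.
have /pinfty_ex_gt0[M M0 MP] := compact_bounded cK.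
exists (1 + \sum_(i < n) M ^+ 2) => [|y Ky].
  by rewrite lerDl sumr_ge0// => i _; exact: sqr_ge0.
rewrite lerD2l ler_sum// => i _; rewrite -real_normK ?num_real// lerXn2r ?nnegrE//.
  exact: ltW.
by rewrite (le_trans (coord_le_norm _ _))// MP.
Qed.

(** From 1 <= [jbr y] <= J on K, both powers with exponents a and -a are at most J^|a|, so one
    constant serves for both bounds. *)
Lemma jbr_powR_bounded (a : R) : exists2 B : R, 0 <= B &
  forall y, K y -> jbr y `^ a <= B /\ 1 <= B * jbr y `^ a.
Proof.
have [J J1 JP] := jbr_bounded.
have ub c y : K y -> jbr y `^ c <= J `^ `|c|.
  move=> Ky; apply: (@le_trans _ _ (jbr y `^ `|c|)).
    by rewrite ler_powR ?jbr_ge1 ?ler_norm.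
  rewrite ge0_ler_powR ?nnegrE ?JP ?(ltW (jbr_gt0 y))//.
  by rewrite (le_trans _ J1).
exists (J `^ `|a|) => [|y Ky]; first exact: powR_ge0.
split; first exact: ub.
have := ub (- a) y Ky; rewrite normrN powRN.
by rewrite -[X in X <= _]mul1r ler_pdivrMr// jbr_powR_gt0.
Qed.

Lemma local_symbol (m rho : R) : local_on K (@symbol_fspace R n m rho).
Proof.
apply: local_weighted => [k|nu].
  have [B B0 BP] := jbr_powR_bounded (- (m - rho * (mi_abs k)%:R) / 2).
  by exists B => // y /BP[].
exists nu => //.
have [B B0 BP] := jbr_powR_bounded (- (m - rho * (mi_abs nu)%:R) / 2).
by exists B => // y /BP[].
Qed.

Lemma local_schwartz : local_on K (@schwartz_fspace R n).
Proof.
apply: local_weighted => [k|nu].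
  have [B B0 BP] := jbr_powR_bounded (k.1%:R / 2).
  by exists B => // y /BP[].
exists (0%N, nu) => //.
have [B B0 BP] := jbr_powR_bounded (0%N%:R / 2).
by exists B => // y /BP[].
Qed.

Lemma local_Cinf : local_on K (@Cinf_fspace R n).
Proof.
split => //.
(* The compact set J of the seminorm is arbitrary: its points in K are bounded by the jets of g, the
   others by the same seminorm of f. *)
- move=> k; exists k.2, 2; split => // f g M sf sg fg M0 gM.
  have f0 : 0 <= Cinf_sn k f := @fs_sn_ge0 (@Cinf_fspace R n) k f sf.
  apply: sup_le_ge0; first by rewrite addr_ge0// mulr_ge0.
  move=> _ [[x nu] [/= Jx nuk] <-]; have [Kx|nKx] := pselect (K x).
    apply: (@le_trans _ _ (M *+ 2)); last by rewrite mulr_natl lerDr.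
    by apply: pderives_cjet_le (gM x Kx) _ => //; rewrite size_mi_seq.
  rewrite /pd (pderives_off _ sf sg)//.
  apply: (@le_trans _ _ (Cinf_sn k f)); last by rewrite lerDl mulr_ge0.
  by apply: (ub_le_sup (Cinf_ubound k sf)); exists (x, nu).
(* Here J = K, with as many derivatives as s has letters. *)
- move=> s; exists (exist _ K cK, size s), 1; split => // f y sf Ky.
  rewrite mul1r (pderives_pd _ sf); apply: (ub_le_sup (Cinf_ubound _ sf)).
  exists (y, mi_count s) => //; split => //=.
  by rewrite mi_abs_count.
Qed.

End local_spaces.

Theorem proposition5p5 (R : realType) (n : nat)
    (K : set 'rV[R]_n) (b : nat -> R)
    (tau : 'rV[R]_n -> 'rV[R]_n -> 'rV[R]_n)
    (K_compact : compact K)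
    (b_ge0 : forall l, 0 <= b l) (b0 : b 0%N = 0)
    (tau_action : smooth_compact_action K b tau) :
  [/\ pullback_polybounded tau (@Cinf_fspace R n),
      forall m rho : R, pullback_polybounded tau (@symbol_fspace R n m rho)
    & pullback_polybounded tau (@schwartz_fspace R n)].
Proof.
have main E (locE : local_on K E) :=
  local_pullback_polybounded K_compact b_ge0 tau_action locE.
split=> [|m rho|]; apply: main.
- exact: local_Cinf.
- exact: local_symbol.
- exact: local_schwartz.
Qed.
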